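(* Let $\alpha\in(0,2)$. There is a constant $C>0$ depending only on $\alpha$ such that for every $h>0$ and every real sequence $f=(f_j)_{j\in\mathbb{Z}}$ with $\sum_jf_j^2M_j^{-1}h<\infty$, $$\|f-\Pi_hf\|_{\ell^2_h(M^{-1})}^2\le C\,\mathcal S_\alpha^h(f,f),$$ where $(\Pi_hf)_j=M_j\,\dfrac{\sum_{k\in\mathbb{Z}}f_k\,h}{\sum_{k\in\mathbb{Z}}M_k\,h}$.
   Context: Equilibrium: $\mu_\alpha(v)=\frac{1}{2\pi}\int_{\mathbb{R}}\exp(iv\xi-|\xi|^\alpha/\alpha)\,d\xi$ and $M_j=\mu_\alpha(jh)>0$, $j\in\mathbb{Z}$. Weights: $C_{1,\alpha}=\frac{2^\alpha\Gamma((\alpha+1)/2)}{\pi^{1/2}|\Gamma(-\alpha/2)|}$ ($\Gamma$ the Gamma function); $\varphi_\alpha(t)=\frac{t^{2-\alpha}}{(2-\alpha)(\alpha-1)\alpha}$ if $\alpha\ne1$ and $\varphi_1(t)=t-t\ln t$. Then $\beta^h_1=\frac{C_{1,\alpha}}{h^{1+\alpha}}\big[\frac1{2-\alpha}-\varphi_\alpha''(1)-\frac{\varphi_\alpha'(3)+3\varphi_\alpha'(1)}2+\varphi_\alpha(3)-\varphi_\alpha(1)\big]$; $\beta^h_k=\frac{2C_{1,\alpha}}{h^{1+\alpha}}\big[\varphi_\alpha'(k+1)+\varphi_\alpha'(k-1)-\varphi_\alpha(k+1)+\varphi_\alpha(k-1)\big]$ for $k=2,4,6,\dots$; $\beta^h_k=\frac{C_{1,\alpha}}{h^{1+\alpha}}\big[-\frac{\varphi_\alpha'(k+2)+6\varphi_\alpha'(k)+\varphi_\alpha'(k-2)}2+\varphi_\alpha(k+2)-\varphi_\alpha(k-2)\big]$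 for $k=3,5,7,\dots$; $\beta^h_{-k}=\beta^h_k$ ($\beta^h_0$ is arbitrary and irrelevant). $\mathcal S_\alpha^h(f,g)=\frac12\sum_{(j,k)\in\mathbb{Z}^2}\beta_k^h(F_j-F_{j+k})(G_j-G_{j+k})M_jh^2$ with $F_j=f_j/M_j$, $G_j=g_j/M_j$. $\|g\|_{\ell^2_h(M^{-1})}^2=\sum_{j\in\mathbb{Z}}g_j^2M_j^{-1}h$. *)

(* Defs.v *)
From HB Require Import structures.
From mathcomp Require Import all_boot all_order all_algebra.
From mathcomp Require Import all_classical all_reals all_analysis.
From mathcomp Require Import measurable_realfun complex.

Set Implicit Arguments.
Unset Strict Implicit.
Unset Printing Implicit Defensive.

Import Order.TTheory GRing.Theory Num.Theory.
Import numFieldNormedType.Exports.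

Local Open Scope classical_set_scope.
Local Open Scope ring_scope.
Local Open Scope complex_scope.

Section definitions.
Context {R : realType}.
Implicit Types (alpha h v t : R) (f g : int -> R).

Definition cexp (z : R[i]) : R[i] :=
  (expR (complex.Re z))%:C * (cos (complex.Im z) +i* sin (complex.Im z)).

Definition Cintegral (F : R -> R[i]) : R[i] :=
  (\int[lebesgue_measure]_x complex.Re (F x))
    +i* (\int[lebesgue_measure]_x complex.Im (F x)).

Definition mu_complex alpha v : R[i] :=
  ((2 * pi)^-1)%:C *
  Cintegral (fun xi => cexp ('i * (v * xi)%:C - (`|xi| `^ alpha / alpha)%:C)).

Definition mu alpha v : R := complex.Re (mu_complex alpha v).

Lemma cexp_itE (v x a : R) :
  cexp ('i * (v * x)%:C - a%:C) =
  (expR (- a) * cos (v * x)) +i* (expR (- a) * sin (v * x)).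
Proof.
have -> : 'i * (v * x)%:C - a%:C = (- a) +i* (v * x) :> R[i].
  by simpc.
by rewrite /cexp /=; simpc.
Qed.

Lemma Rintegral_odd (g : R -> R) : measurable_fun [set: R] g ->
  (forall x, g (- x) = - g x) -> \int[lebesgue_measure]_x g x = 0.
Proof.
move=> mg og; rewrite /Rintegral integralE.
suff <- : (\int[lebesgue_measure]_x (EFin \o g)^\+ x =
           \int[lebesgue_measure]_x (EFin \o g)^\- x)%E.
  by case: (\int[_]_x _)%E => [r| |] //=; rewrite subrr.
transitivity (\int[pushforward lebesgue_measure
    (-%R : _ -> measurableTypeR R)]_x (EFin \o g)^\+ x)%E.
  by apply: eq_measure_integral => //= A mA _; exact/esym/lebesgue_measureN.
rewrite ge0_integral_pushforward//=; last first.
  by apply: measurable_funepos; apply/measurable_EFinP.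
rewrite preimage_setT.
by apply: eq_integral => x _; rewrite funeposE funenegE /= og EFinN.
Qed.

(* The imaginary part of the Fourier integral vanishes by oddness, so that
   taking the real part in [mu] loses nothing. *)
Lemma mu_complexE alpha v : mu_complex alpha v = (mu alpha v)%:C.
Proof.
rewrite /mu /mu_complex /Cintegral.
rewrite [X in _ +i* X](_ : _ = 0); last first.
  under eq_Rintegral do rewrite cexp_itE /=.
  apply: Rintegral_odd => [|x].
    apply: measurable_funM; apply: measurableT_comp => //.
      apply: measurableT_comp => //; apply: measurable_funM => //.
      exact: (measurableT_comp (measurable_powR _) (@normr_measurable _ _)).
    by apply: continuous_measurable_fun; exact: continuous_sin.
  by rewrite normrN mulrN sinN mulrN.
by simpc.
Qed.

Definition M alpha h (j : int) : R := mu alpha (j%:~R * h).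

Definition Gamma_pos (s : R) : R :=
  \int[lebesgue_measure]_(t in `]0%R, +oo[) (t `^ (s - 1) * expR (- t)).

(* For s <= 0 the analytic continuation is obtained from the functional
   equation Gamma (s + 1) = s * Gamma s, applied the least number n of times
   that makes s + n positive; at a pole the product is 0, and so is Gamma. *)
Definition Gamma (s : R) : R :=
  let n := if 0 < s then 0%N else (Num.truncn (- s)).+1 in
  Gamma_pos (s + n%:R) / \prod_(i < n) (s + i%:R).

Definition C1 alpha : R :=
  2 `^ alpha * Gamma ((alpha + 1) / 2) / (Num.sqrt pi * `|Gamma (- alpha / 2)|).

Definition phi alpha t : R :=
  if alpha == 1 then t - t * ln t
  else t `^ (2 - alpha) / ((2 - alpha) * (alpha - 1) * alpha).

(* The value at k = 0 is immaterial: it is only ever multiplied by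
   F j - F (j + 0) = 0. *)
Definition betah alpha h (k : int) : R :=
  let n := `|k|%N in
  let p := phi alpha in
  let p' := derive1 p in
  let p'' := derive1n 2 p in
  let c := C1 alpha / h `^ (1 + alpha) in
  if n == 0%N then 0
  else if n == 1%N then
    c * ((2 - alpha)^-1 - p'' 1 - (p' 3 + 3 * p' 1) / 2 + p 3 - p 1)
  else if ~~ odd n then
    2 * c * (p' (n%:R + 1) + p' (n%:R - 1) - p (n%:R + 1) + p (n%:R - 1))
  else
    c * (- ((p' (n%:R + 2) + 6 * p' n%:R + p' (n%:R - 2)) / 2)
         + p (n%:R + 2) - p (n%:R - 2)).

(* Unconditional sum of a real family: the usual one as soon as the family is
   nonnegative (possibly +oo) or absolutely summable. *)
Definition ssum (T : choiceType) (a : T -> R) : \bar R :=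
  (\esum_(i in [set: T]) (EFin \o a)^\+ i
   - \esum_(i in [set: T]) (EFin \o a)^\- i)%E.

(* The squared norm, +oo when the family is not in the weighted l2 space. *)
Definition l2norm_sq alpha h g : \bar R :=
  ssum (fun j : int => g j ^+ 2 / M alpha h j * h).

(* [betah alpha h k] (k <> 0) and [M alpha h j] are positive for 0 < alpha < 2
   and h > 0, so [Sform alpha h f f] is a sum of nonnegative terms. *)
Definition Sform alpha h f g : \bar R :=
  let F j := f j / M alpha h j in
  let G j := g j / M alpha h j in
  ((2^-1)%:E *
   ssum (fun jk : int * int => let: (j, k) := jk in
     betah alpha h k * (F j - F (j + k)) * (G j - G (j + k))
     * M alpha h j * h ^+ 2)%R)%E.

(* Both sums converge absolutely when [l2norm_sq alpha h f] is finite, by the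
   Cauchy-Schwarz inequality and the summability of M, so [fine] is harmless. *)
Definition Pi alpha h f (j : int) : R :=
  M alpha h j * (fine (ssum (fun k : int => f k * h))
                 / fine (ssum (fun k : int => M alpha h k * h))).

End definitions.

(* Main.v *)
(* Write F = f / M and m for the total mass of the weights M_j h. By Jensen,
   (F_j - <F>)^2 is at most the average over k, with weights M_k h / m, of
   (F_j - F_k)^2, so the inequality follows from M_j M_k <= C (M_j + M_k)
   beta_(k-j) and a positive lower bound on m. If |k| <= |j|, then |k - j| <=
   2 |j|, so the first bound is a consequence of mu v <= C |v|^-(1+alpha) and
   beta_k >= c (|k| h)^-(1+alpha).

   Positivity and decay of the stable density mu come from the fact that exp
   (- |x|^alpha / alpha) is a limit of positive mixtures of Gaussians of
   total mass at most 1: with a = alpha / 2 and y = exp (- d x^2), the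
   function (1 - (1 - y)^a)^n is a power series in y with nonnegative
   coefficients, and it tends to exp (- lam x^(2a)) when d^a = lam / n. For
   such a mixture f with cosine transform g one has |v| g(v) <= C (1 - f (1 /
   v)), and g is log-convex in v^2, so that g cannot vanish.

   The brackets in beta_k are integrals of t^-(1+alpha), the third derivative
   of phi, against quadratic splines. For odd k >= 3 the spline changes sign;
   normalized by k^(1+alpha), the bracket is smallest for k = 3 in the limit
   alpha = 2, where it is positive because ln 5 > 8 / 5. *)
Require Import Defs.
From mathcomp Require Import all_boot all_order all_algebra.
From mathcomp Require Import all_classical all_reals all_analysis.
From mathcomp Require Import measurable_realfun complex.
From mathcomp Require Import ring lra.

Set Implicit Arguments.
Unset Strict Implicit.
Unset Printing Implicit Defensive.

Import Order.TTheory GRing.Theory Num.Theory.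
Import numFieldNormedType.Exports.
Local Open Scope classical_set_scope.
Local Open Scope ring_scope.

(** * Cosine transform of Gaussians *)

Section integrals.
Context {R : realType}.
Notation leb := (@lebesgue_measure R).
Implicit Types (f g : R -> R).

(** Strict positivity does not survive pointwise limits. What is carried from finite Gaussian
    mixtures to the stable function is therefore a pair of non-strict inequalities, [midlogconvex]
    and [tail_bounded], both with absolute constants; strict positivity is recovered only at the
    end, from log-convexity and continuity at 0.

    Three limits follow one another: the truncation order of the binomial series, the power n, and
    the parameter of an auxiliary Gaussian factor. The factor provides an integrable bound common to
    all the approximants in the first two limits; in the third it disappears, and the stable
    function itself dominates.

    Uniformity in h has two sources. Decay of the density and lower bound of the weights both carry
    the power -(1 + alpha) of h, which cancels when they are compared. The mass m enters only
    through 1 / m, so that just its lower bound must be uniform; its finiteness is proved for each h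
    separately. *)

Lemma integrable_ler f g : measurable_fun [set: R] f ->
  (forall x, `|f x| <= g x) -> leb.-integrable [set: R] (EFin \o g) ->
  leb.-integrable [set: R] (EFin \o f).
Proof.
move=> mf fg; apply: le_integrable => //; first exact/measurable_EFinP.
by move=> x _ /=; rewrite lee_fin (le_trans (fg x))// ler_norm.
Qed.

Lemma measurable_integrable f :
  leb.-integrable [set: R] (EFin \o f) -> measurable_fun [set: R] f.
Proof. by move=> /measurable_int /measurable_EFinP. Qed.

(** Convergence is asked only off the null set {0}: at x = 0 a Gaussian takes the value 1, the
    endpoint of the binomial series, which [binpoly_cvg] leaves out. *)
Lemma Rintegral_dominated_cvg (F : (R -> R)^nat) f g :
  (forall n, measurable_fun [set: R] (F n)) -> measurable_fun [set: R] f ->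
  (forall x : R, x != 0 -> F n x @[n --> \oo] --> f x) ->
  leb.-integrable [set: R] (EFin \o g) ->
  (forall n x, `|F n x| <= g x) ->
  \int[leb]_x F n x @[n --> \oo] --> \int[leb]_x f x.
Proof.
move=> mF mf Ff ig Fg.
have mEF n : measurable_fun [set: R] (EFin \o F n) by exact/measurable_EFinP.
have mEf : measurable_fun [set: R] (EFin \o f) by exact/measurable_EFinP.
have cvg_ae : {ae leb, forall x, [set: R] x ->
    (fun n => (EFin \o F n) x) @ \oo --> (EFin \o f) x}.
  exists [set 0]; split => //; first by rewrite lebesgue_measure_set1.
  move=> x /= /not_implyP[_ Hx]; apply: contrapT => /eqP x0; apply: Hx.
  by apply: cvg_EFin (Ff x x0); exact: nearW.
have [i _ c] := @dominated_convergence _ _ _ leb _ measurableT _ _ _ mEF mEf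
  cvg_ae ig
  (aeW leb (fun x n _ => Fg n x : (`|(EFin \o F n) x| <= (EFin \o g) x)%E)).
by apply: fine_cvg; rewrite fineK//; exact: integrable_fin_num.
Qed.

Lemma Rintegral_derive_eq0 (F f : R -> R) : continuous f ->
  (forall x : R, is_derive x 1 F (f x)) ->
  leb.-integrable [set: R] (EFin \o f) ->
  F n%:R @[n --> \oo] --> 0 -> F (- n%:R) @[n --> \oo] --> 0 ->
  \int[leb]_x f x = 0.
Proof.
move=> cf dF intf Fp Fn.
(* The successor keeps the interval nondegenerate for every n, as the fundamental theorem of
   calculus requires. *)
pose B n := `[- n.+1%:R, n.+1%:R]%classic : set R.
have c1 : \int[leb]_x (f x * \1_(B n) x) @[n --> \oo] --> \int[leb]_x f x.
  apply: (@Rintegral_dominated_cvg _ _ (fun x => `|f x|)).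
  - move=> n; apply: measurable_funM; first exact: measurable_integrable.
    by apply: measurable_indic; exact: measurable_itv.
  - exact: measurable_integrable.
  - move=> x _; apply: cvg_near_cst.
    exists (Num.truncn `|x|) => // n /= xn.
    rewrite indicE mem_set ?mulr1// /B/= in_itv/= -ler_norml.
    by apply: ltW; apply: lt_le_trans (truncnS_gt _) _; rewrite ler_nat ltnS.
  - exact: integrable_norm intf.
  - move=> n x; rewrite normrM ler_piMr// indicE.
    by case: (_ \in _) => /=; rewrite ?normr1 ?normr0.
have c2 : F n.+1%:R - F (- n.+1%:R) @[n --> \oo] --> 0.
  rewrite -(subr0 0); apply: cvgB.
    by rewrite (cvg_shiftS (fun n => F n%:R)).
  by rewrite (cvg_shiftS (fun n => F (- n%:R))).
apply: cvg_unique c1 _ => //.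
apply: cvg_trans c2; apply: near_eq_cvg; apply: nearW => n.
transitivity (\int[leb]_(x in B n) f x).
  rewrite /Rintegral (@continuous_FTC2 _ f F)//.
  - by rewrite ltrNl (@lt_trans _ _ 0)// ?oppr_lt0 ltr0n.
  - exact: continuous_subspaceT.
  - have cF : continuous F.
      by move=> x; apply/differentiable_continuous/derivable1_diffP/ex_derive.
    split; first by move=> x _; have [] := dF x.
      by apply: cvg_at_right_filter; exact: cF.
    by apply: cvg_at_left_filter; exact: cF.
  - by move=> x _; rewrite derive1E derive_val.
rewrite Rintegral_mkcond; apply: eq_Rintegral => x _.
by rewrite patchE indicE; case: ifP; rewrite ?mulr1 ?mulr0.
Qed.

Definition gauss (s x : R) := expR (- (s * x ^+ 2)).

Lemma gauss_normal (s : R) : 0 < s -> forall x, gauss s x =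
  normal_pdf 0 (Num.sqrt (2 * s)^-1) x * Num.sqrt (pi / s).
Proof.
move=> s0 x.
have s20 : 0 < (2 * s)^-1 by rewrite invr_gt0 mulr_gt0.
rewrite normal_pdfE ?gt_eqF ?sqrtr_gt0// /normal_peak /normal_fun.
rewrite sqr_sqrtr ?(ltW s20)// subr0.
have -> : ((2 * s)^-1 * pi *+ 2) = pi / s by rewrite -mulr_natr; field; lra.
rewrite mulrAC mulVf ?mul1r; last by rewrite gt_eqF// sqrtr_gt0 divr_gt0//
  pi_gt0.
by rewrite /gauss; congr expR; rewrite -mulr_natr; field; lra.
Qed.

Lemma integrable_gauss s : 0 < s ->
  leb.-integrable [set: R] (EFin \o gauss s).
Proof.
move=> s0; have := integrable_normal_pdf 0 (Num.sqrt (2 * s)^-1).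
move/(integrableZr measurableT (Num.sqrt (pi / s))).
apply: eq_integrable => // x _ /=.
by rewrite gauss_normal// EFinM.
Qed.

Lemma Rintegral_gauss s : 0 < s ->
  \int[leb]_x gauss s x = Num.sqrt (pi / s).
Proof.
move=> s0; under eq_Rintegral do rewrite gauss_normal//.
rewrite RintegralZr//; last exact: integrable_normal_pdf.
by rewrite /Rintegral integral_normal_pdf /= mul1r.
Qed.

Lemma continuous_gauss s : continuous (gauss s).
Proof.
move=> x; apply: continuous_comp; last exact: continuous_expR.
apply: continuousN; apply: continuousM; first exact: cst_continuous.
exact: exprn_continuous.
Qed.

Lemma continuous_cosM (v : R) : continuous (fun x : R => cos (v * x)).
Proof.
move=> x; apply: (continuous_comp (f := fun x => v * x)).
  exact: mulrl_continuous.
exact: continuous_cos.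
Qed.

Lemma continuous_sinM (v : R) : continuous (fun x : R => sin (v * x)).
Proof.
move=> x; apply: (continuous_comp (f := fun x => v * x)).
  exact: mulrl_continuous.
exact: continuous_sin.
Qed.

Lemma measurable_cosM (v : R) : measurable_fun [set: R] (fun x : R => cos (v *
  x)).
Proof. by apply: continuous_measurable_fun; exact: continuous_cosM. Qed.

Lemma measurable_sinM (v : R) : measurable_fun [set: R] (fun x : R => sin (v *
  x)).
Proof. by apply: continuous_measurable_fun; exact: continuous_sinM. Qed.

Lemma normM_le1 (x c : R) : `|c| <= 1 -> `|x * c| <= `|x|.
Proof. by move=> c1; rewrite normrM ler_piMr. Qed.

Lemma abs_cos_le1 (x : R) : `|cos x| <= 1.
Proof. by rewrite ler_norml cos_geN1 cos_le1. Qed.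

Lemma abs_sin_le1 (x : R) : `|sin x| <= 1.
Proof. by rewrite ler_norml sin_geN1 sin_le1. Qed.

Lemma gauss_ge0 s x : 0 <= gauss s x. Proof. exact: expR_ge0. Qed.

(** Half of the exponent pays for the factor x: |x| <= 1 + x^2 <= (1 + 2/s) (1 + s x^2 / 2), and the
    last factor is at most exp (s x^2 / 2). *)
Lemma xgauss_le (s x : R) : 0 < s ->
  `|x * gauss s x| <= (1 + 2 / s) * gauss (s / 2) x.
Proof.
move=> s0; rewrite normrM (ger0_norm (gauss_ge0 _ _)).
have -> : gauss s x = gauss (s / 2) x * gauss (s / 2) x.
  by rewrite /gauss -expRD; congr expR; field.
rewrite mulrA ler_wpM2r ?gauss_ge0//.
rewrite /gauss expRN ler_pdivrMr ?expR_gt0//.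
have e1 := expR_ge1Dx (s / 2 * x ^+ 2).
have xx : `|x| <= 1 + x ^+ 2.
  by rewrite -real_normK ?num_real//; have := sqr_ge0 (`|x| - 1); nra.
apply: (le_trans xx); apply: (@le_trans _ _ ((1 + 2 / s) * (1 + s /
  2 * x ^+ 2))).
  have -> : (1 + 2 / s) * (1 + s / 2 * x ^+ 2) = (1 + x ^+ 2) + 2 / s + s /
    2 * x ^+ 2.
    by field; lra.
  have : 0 <= 2 / s by rewrite divr_ge0// ltW.
  have : 0 <= s / 2 * x ^+ 2 by rewrite mulr_ge0// ?sqr_ge0// divr_ge0// ltW.
  lra.
by rewrite ler_wpM2l// addr_ge0// divr_ge0// ltW.
Qed.

Definition cosint (f : R -> R) (v : R) : R := \int[leb]_x (f x * cos (v * x)).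

Lemma integrable_Mcos f (v : R) : leb.-integrable [set: R] (EFin \o f) ->
  leb.-integrable [set: R] (EFin \o (fun x => f x * cos (v * x))).
Proof.
move=> intf; apply: (@integrable_ler _ (fun x => `|f x|)).
- apply: measurable_funM; first exact: measurable_integrable.
  exact: measurable_cosM.
- by move=> x; exact/normM_le1/abs_cos_le1.
- exact: integrable_norm intf.
Qed.

Lemma is_derive_gauss (s x : R) :
  is_derive x 1 (gauss s) (- (2 * s * x) * gauss s x).
Proof.
rewrite /gauss; apply: is_derive_eq.
rewrite /GRing.scale/= /GRing.scale/=; ring.
Qed.

Lemma is_derive_cosM (v x : R) :
  is_derive x 1 (fun x => cos (v * x)) (- v * sin (v * x)).
Proof.
apply: is_derive_eq.
rewrite /GRing.scale/= /GRing.scale/=; ring.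
Qed.

Lemma is_derive_sinM (v x : R) :
  is_derive x 1 (fun x => sin (v * x)) (v * cos (v * x)).
Proof.
apply: is_derive_eq.
rewrite /GRing.scale/= /GRing.scale/=; ring.
Qed.

Lemma integrable_xgauss (s : R) : 0 < s ->
  leb.-integrable [set: R] (EFin \o (fun x => x * gauss s x)).
Proof.
move=> s0; apply: (@integrable_ler _ (fun x => (1 + 2 / s) * gauss (s / 2) x)).
- apply: continuous_measurable_fun => x; apply: cvgM; first exact: cvg_id.
  exact: continuous_gauss.
- by move=> x; exact: xgauss_le.
- have /(integrableZl measurableT (1 + 2 / s)) :=
    @integrable_gauss (s / 2) (divr_gt0 s0 (ltr0Sn _ _)).
  by apply: eq_integrable => // x _ /=; rewrite EFinM.
Qed.

Lemma gauss_cvg0 (s : R) : 0 < s -> gauss s n%:R @[n --> \oo] --> 0.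
Proof.
move=> s0; apply: (@squeeze_cvgr _ _ _ _ (cst 0) (fun n => s^-1 * harmonic n)).
- near=> n; rewrite gauss_ge0/= /gauss expRN -invfM lef_pV2 ?posrE ?expR_gt0//.
    apply: (le_trans _ (expR_ge1Dx _)).
    (* From n = 2 on, n + 1 <= n^2, so that exp (s n^2) >= s (n + 1). *)
    have n2 : 2 <= (n%:R : R).
      by rewrite (ler_nat _ 2); near: n; exact: nbhs_infty_ge.
    have : s * n.+1%:R <= s * n%:R ^+ 2 by rewrite ler_pM2l// expr2 -natr1; nra.
    by lra.
  by rewrite mulr_gt0// ltr0n.
- exact: cvg_cst.
- rewrite -(mulr0 s^-1); apply: cvgM; first exact: cvg_cst.
  exact: cvg_harmonic.
Unshelve. all: end_near. Qed.

Lemma integrable_xgauss_sin (s v : R) : 0 < s ->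
  leb.-integrable [set: R] (EFin \o (fun x => x * gauss s x * sin (v * x))).
Proof.
move=> s0; have ixg := integrable_xgauss s0.
apply: (@integrable_ler _ (fun x => `|x * gauss s x|)).
- apply: measurable_funM; first exact: measurable_integrable.
  exact: measurable_sinM.
- by move=> x; exact/normM_le1/abs_sin_le1.
- exact: integrable_norm ixg.
Qed.

(** Integration by parts: the derivative of exp (- s x^2) sin (v x) has integral 0. This expresses
    the derivative in v of the cosine transform by the transform itself, a linear differential
    equation that [cosint_gauss] solves. *)
Lemma Rintegral_xgauss_sin (s v : R) : 0 < s ->
  \int[leb]_x (x * gauss s x * sin (v * x)) = v / (2 * s) * cosint (gauss s) v.
Proof.
move=> s0.
have i1 := integrable_xgauss_sin v s0.
have i2 := @integrable_Mcos (gauss s) v (integrable_gauss s0).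
have /(integrableZl measurableT (- (2 * s))) j1 := i1.
have /(integrableZl measurableT v) j2 := i2.
have H0 : \int[leb]_x (- (2 * s) * (x * gauss s x * sin (v * x)) +
    v * (gauss s x * cos (v * x))) = 0.
  apply: (@Rintegral_derive_eq0 (fun x => gauss s x * sin (v * x))).
  - move=> x; apply: cvgD; apply: cvgM; first exact: cvg_cst.
    + apply: cvgM; last exact: continuous_sinM.
      by apply: cvgM; [exact: cvg_id|exact: continuous_gauss].
    + exact: cvg_cst.
    + by apply: cvgM; [exact: continuous_gauss|exact: continuous_cosM].
  - move=> x.
    have := is_derive_gauss s x; have := is_derive_sinM v x => ds dg.
    apply: is_derive_eq.
    rewrite /GRing.scale/=; ring.
  - have := integrableD measurableT j1 j2.
    by apply: eq_integrable => // x _ /=; rewrite EFinD !EFinM.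
  - apply: norm_cvg0.
    apply: (@squeeze_cvgr _ _ _ _ (cst 0) (fun n => gauss s n%:R)).
    + apply: nearW => n /=; rewrite normr_ge0/=.
      rewrite (le_trans (normM_le1 _ (abs_sin_le1 _)))//.
      by rewrite ger0_norm// gauss_ge0.
    + exact: cvg_cst.
    + exact: gauss_cvg0.
  - apply: norm_cvg0.
    apply: (@squeeze_cvgr _ _ _ _ (cst 0) (fun n => gauss s n%:R)).
    + apply: nearW => n /=; rewrite normr_ge0/=.
      rewrite (le_trans (normM_le1 _ (abs_sin_le1 _)))//.
      by rewrite ger0_norm ?gauss_ge0// /gauss sqrrN.
    + exact: cvg_cst.
    + exact: gauss_cvg0.
move: H0; rewrite RintegralD//.
rewrite !RintegralZl// -/(cosint _ _) => H0.
apply: (@mulfI _ (2 * s)); first by rewrite gt_eqF// mulr_gt0.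
have -> : 2 * s * (v / (2 * s) * cosint (gauss s) v) = v * cosint (gauss s) v.
  by field; lra.
by lra.
Qed.

Lemma is_derive_cosint_gauss (s v : R) : 0 < s ->
  is_derive v 1 (cosint (gauss s)) (- (v / (2 * s)) * cosint (gauss s) v).
Proof.
move=> s0.
pose f (v x : R) := gauss s x * cos (v * x).
have df (w x : R) : is_derive w 1 (f ^~ x) (- (x * gauss s x * sin (w * x))).
  rewrite /f; under eq_fun do rewrite [_ * x]mulrC.
  have := is_derive_cosM x w => dc.
  apply: is_derive_eq; rewrite /GRing.scale/= (mulrC x w); ring.
have vI : `]v - 1, v + 1[%classic v by rewrite /= in_itv/=; lra.
have E1 x : partial1of2 f v x = - (x * gauss s x * sin (v * x)).
  by rewrite partial1of2E (@derive_val _ _ _ _ _ _ _ (df v x)).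
have intf x : `]v - 1, v + 1[%classic x -> leb.-integrable [set: R] (EFin \o f
  x).
  by move=> _; exact/integrable_Mcos/integrable_gauss.
have derf x y : `]v - 1, v + 1[%classic x -> [set: R] y -> derivable (f ^~ y) x
  1.
  by move=> _ _; have [] := df x y.
have bnd x y : `]v - 1, v + 1[%classic x -> [set: R] y ->
    `|partial1of2 f x y| <= `|y * gauss s y|.
  move=> _ _; rewrite partial1of2E (@derive_val _ _ _ _ _ _ _ (df x y)) normrN.
  exact/normM_le1/abs_sin_le1.
have intG := integrable_norm (integrable_xgauss s0).
have D := @derivable_under_integral R _ _ leb f _ measurableT v (v - 1) (v + 1)
  vI intf derf (fun y => `|y * gauss s y|) (fun=> normr_ge0 _) intG bnd.
have E := @differentiation_under_integral R _ _ leb f _ measurableT v (v - 1) (v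
  + 1)
  vI intf derf (fun y => `|y * gauss s y|) (fun=> normr_ge0 _) intG bnd.
apply: DeriveDef; first exact: D.
rewrite -derive1E [LHS]E.
under eq_Rintegral do rewrite E1.
under eq_Rintegral do rewrite -mulN1r.
rewrite RintegralZl//.
  by rewrite Rintegral_xgauss_sin// mulN1r mulNr.
exact: integrable_xgauss_sin.
Qed.

Lemma cosint_gauss (s v : R) : 0 < s ->
  cosint (gauss s) v = Num.sqrt (pi / s) * expR (- (v ^+ 2 / (4 * s))).
Proof.
move=> s0.
pose H w := cosint (gauss s) w * expR (w ^+ 2 / (4 * s)).
have dH (w : R) : is_derive w 1 H 0.
  have := @is_derive_cosint_gauss s w s0 => dc.
  rewrite /H; apply: is_derive_eq.
  rewrite /GRing.scale/= /GRing.scale/=; field; lra.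
have := @is_derive_0_is_cst _ H v 0 dH.
rewrite /H expr0n/= mul0r expR0 mulr1.
have -> : cosint (gauss s) 0 = Num.sqrt (pi / s).
  rewrite -Rintegral_gauss//; apply: eq_Rintegral => x _.
  by rewrite mul0r cos0 mulr1.
by move=> <-; rewrite expRN mulfK// gt_eqF// expR_gt0.
Qed.

End integrals.

(** * Gaussian mixtures *)

(** The sum of A_i (t - e_i)^2 is a nonnegative quadratic in t; its value at the vertex t = S1 / S0
    gives the inequality. *)
Lemma sum_cauchy_schwarz (R : realFieldType) (I : Type) (r : seq I)
    (P : pred I) (A e : I -> R) : (forall i, P i -> 0 <= A i) ->
  (\sum_(i <- r | P i) A i * e i) ^+ 2 <=
  (\sum_(i <- r | P i) A i) * \sum_(i <- r | P i) A i * e i ^+ 2.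
Proof.
move=> A0.
set S0 := \sum_(i <- r | P i) A i; set S1 := \sum_(i <- r | P i) A i * e i.
set S2 := \sum_(i <- r | P i) _.
have H t : 0 <= S0 * t ^+ 2 - 2 * t * S1 + S2.
  rewrite /S0 /S1 /S2 mulr_suml mulr_sumr -sumrB -big_split/=.
  apply: sumr_ge0 => i Pi.
  have -> : A i * t ^+ 2 - 2 * t * (A i * e i) + A i * e i ^+ 2 =
    A i * (t - e i) ^+ 2 by ring.
  by rewrite mulr_ge0// ?A0// sqr_ge0.
have S00 : 0 <= S0 by exact: sumr_ge0.
have [S0z|S0p] := leP S0 0.
  have {S0z S00} S0z : S0 = 0 by apply/eqP; rewrite eq_le S0z.
  have [->|S1z] := eqVneq S1 0; first by rewrite S0z expr0n mul0r.
  (* With S0 = 0 the quadratic is affine, and if its slope were nonzero this t would give it the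
     value -1. *)
  have := H ((S2 + 1) / (2 * S1)); rewrite S0z mul0r add0r.
  have -> : 2 * ((S2 + 1) / (2 * S1)) * S1 = S2 + 1 by field.
  lra.
have := H (S1 / S0).
have -> : S0 * (S1 / S0) ^+ 2 - 2 * (S1 / S0) * S1 + S2 = (S0 * S2 - S1 ^+ 2) /
  S0.
  by field; rewrite gt_eqF.
by rewrite pmulr_lge0 ?invr_gt0// subr_ge0.
Qed.

Section mixtures.
Context {R : realType}.
Notation leb := (@lebesgue_measure R).

Lemma integrable_mix (n : nat) (w s : nat -> R) : (forall i, 0 < s i) ->
  leb.-integrable [set: R] (EFin \o (fun x => \sum_(i < n) w i * gauss (s i)
    x)).
Proof.
move=> s0; elim: n => [|n ih].
  rewrite [X in _ \o X](_ : _ = cst 0); first exact: integrable0.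
  by apply/funext => x; rewrite big_ord0.
have /(integrableZl measurableT (w n)) i2 := integrable_gauss (s0 n).
have := integrableD measurableT ih i2.
by apply: eq_integrable => // x _ /=; rewrite big_ord_recr.
Qed.

Lemma cosint_mix (n : nat) (w s : nat -> R) (v : R) : (forall i, 0 < s i) ->
  cosint (fun x => \sum_(i < n) w i * gauss (s i) x) v =
  \sum_(i < n) w i * cosint (gauss (s i)) v.
Proof.
move=> s0; elim: n => [|n ih].
  rewrite big_ord0 /cosint.
  under eq_Rintegral do rewrite big_ord0 mul0r.
  by rewrite Rintegral_cst// mul0r.
rewrite big_ord_recr/= -ih /cosint.
rewrite -RintegralZl//; last exact/integrable_Mcos/integrable_gauss.
rewrite -RintegralD//.
- apply: eq_Rintegral => x _; rewrite big_ord_recr/=; ring.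
- exact/integrable_Mcos/integrable_mix.
- have /(integrableZl measurableT (w n)) :=
    @integrable_Mcos R _ v (integrable_gauss (s0 n)).
  by apply: eq_integrable.
Qed.

(* [v] and [w] with [v ^+ 2 = 2 * w ^+ 2]: the cosine transform of a Gaussian
   mixture is a Laplace transform in [v ^+ 2], hence log-convex there. *)
Definition midlogconvex (f : R -> R) := forall v w : R, v ^+ 2 = 2 * w ^+ 2 ->
  cosint f w ^+ 2 <= cosint f 0 * cosint f v.

(** A density analogue of the truncation inequality, which controls tails by the behaviour of a
    characteristic function near 0. It is affine in f with an absolute constant, so it passes to
    mixtures; the 1 on the right stands for the total mass, which need only be at most 1. *)
Definition tail_bounded (f : R -> R) := forall v : R, v != 0 ->
  `|v| * cosint f v <= 64 * Num.sqrt pi * (1 - f v^-1).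

(** Cauchy-Schwarz with weights [A i] and nodes [e i]: the relation v^2 = 2 u^2 squares each
    exponential, so the three transforms are the moments of order 0, 1 and 2. *)
Lemma midlogconvex_mix (n : nat) (w s : nat -> R) : (forall i, 0 < s i) ->
  (forall i, 0 <= w i) ->
  midlogconvex (fun x => \sum_(i < n) w i * gauss (s i) x).
Proof.
move=> s0 w0 v u vu; rewrite !cosint_mix//.
pose A (i : 'I_n) := w i * Num.sqrt (pi / s i).
pose e (i : 'I_n) := expR (- (u ^+ 2 / (4 * s i))).
have := @sum_cauchy_schwarz R _ (index_enum 'I_n) predT A e.
have -> : \sum_(i < n) w i * cosint (gauss (s i)) u = \sum_(i < n) A i * e i.
  by apply: eq_bigr => i _; rewrite cosint_gauss// mulrA.
have -> : \sum_(i < n) w i * cosint (gauss (s i)) 0 = \sum_(i < n) A i.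
  apply: eq_bigr => i _.
  by rewrite cosint_gauss// expr0n/= mul0r oppr0 expR0 mulr1.
have -> : \sum_(i < n) w i * cosint (gauss (s i)) v =
    \sum_(i < n) A i * e i ^+ 2.
  apply: eq_bigr => i _; rewrite cosint_gauss// mulrA; congr (_ * _).
  rewrite /e -expRM_natl vu; congr expR; rewrite -mulr_natl; field.
  by rewrite gt_eqF.
by apply => i _; rewrite mulr_ge0// sqrtr_ge0.
Qed.

(** In r = v^2 / s the claim reads sqrt r exp (- r/4) <= 64 (1 - exp (- 1/r)). Here 1 - exp (- 1/r)
    >= 1 / (1 + r) and sqrt r <= 1 + r, while 64 exp (r/4) >= 64 (1 + r/8)^2 = (8 + r)^2 >= (1 +
    r)^2; hence the constant 64. *)
Lemma gauss_tail (s v : R) : 0 < s -> v != 0 ->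
  `|v| * cosint (gauss s) v <= 64 * Num.sqrt pi * (1 - gauss s v^-1).
Proof.
move=> s0 v0; rewrite cosint_gauss//.
pose r := v ^+ 2 / s.
have r0 : 0 < r by rewrite divr_gt0// exprn_even_gt0.
have -> : `|v| * (Num.sqrt (pi / s) * expR (- (v ^+ 2 / (4 * s)))) =
    Num.sqrt pi * (Num.sqrt r * expR (- (r / 4))).
  have E : `|v| * Num.sqrt (pi / s) = Num.sqrt pi * Num.sqrt r.
    rewrite -sqrtr_sqr -!sqrtrM ?sqr_ge0 ?pi_ge0//; congr Num.sqrt.
    by rewrite /r; ring.
  rewrite [LHS]mulrA E -mulrA; congr (_ * (_ * expR _)).
  by rewrite /r; field; lra.
rewrite (mulrC 64) -[leRHS]mulrA ler_wpM2l ?sqrtr_ge0//.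
have -> : gauss s v^-1 = expR (- r^-1).
  rewrite /gauss /r; congr expR; field.
  by rewrite v0 gt_eqF.
have h1 : (1 + r)^-1 <= 1 - expR (- r^-1).
  have : expR (- r^-1) <= (1 + r^-1)^-1.
    rewrite expRN lef_pV2 ?posrE ?expR_gt0 ?expR_ge1Dx//.
    by rewrite addr_gt0// invr_gt0.
  have -> : (1 + r^-1)^-1 = 1 - (1 + r)^-1.
    by field; rewrite !gt_eqF//; lra.
  by lra.
apply: (@le_trans _ _ (64 * (1 + r)^-1)); last by rewrite ler_pM2l.
rewrite expRN ler_pdivrMr ?expR_gt0// mulrAC ler_pdivlMr; last by lra.
have sr : Num.sqrt r <= 1 + r.
  have := sqr_sqrtr (ltW r0); have := sqrtr_ge0 r.
  by move: (Num.sqrt r) => q q0; nra.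
apply: (@le_trans _ _ ((1 + r) * (1 + r))); first by rewrite ler_wpM2r//; lra.
have -> : expR (r / 4) = expR (r / 8) ^+ 2.
  by rewrite -expRM_natl; congr expR; field.
have := expR_ge1Dx (r / 8).
move: (expR (r / 8)) => q qr.
have : (1 + r / 8) ^+ 2 <= q ^+ 2 by rewrite lerXn2r// nnegrE; lra.
by nra.
Qed.

Lemma tail_bounded_mix (n : nat) (w s : nat -> R) : (forall i, 0 < s i) ->
  (forall i, 0 <= w i) -> \sum_(i < n) w i <= 1 ->
  tail_bounded (fun x => \sum_(i < n) w i * gauss (s i) x).
Proof.
move=> s0 w0 w1 v v0; rewrite cosint_mix//.
apply: (@le_trans _ _ (\sum_(i < n) w i * (64 * Num.sqrt pi * (1 - gauss (s i)
  v^-1)))).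
  rewrite mulr_sumr; apply: ler_sum => i _; rewrite mulrCA.
  by rewrite ler_wpM2l// gauss_tail.
under eq_bigr do rewrite mulrCA.
rewrite -mulr_sumr ler_wpM2l ?mulr_ge0 ?sqrtr_ge0//.
under eq_bigr do rewrite mulrBr mulr1.
by rewrite sumrB lerD2r.
Qed.

Lemma cosint_dominated_cvg (F : (R -> R)^nat) (f g : R -> R) (v : R) :
  (forall n, measurable_fun [set: R] (F n)) -> measurable_fun [set: R] f ->
  (forall x : R, x != 0 -> F n x @[n --> \oo] --> f x) ->
  leb.-integrable [set: R] (EFin \o g) ->
  (forall n x, `|F n x| <= g x) ->
  cosint (F n) v @[n --> \oo] --> cosint f v.
Proof.
move=> mF mf Ff ig Fg; apply: (@Rintegral_dominated_cvg R _ _ g) => //.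
- by move=> n; apply: measurable_funM => //; exact: measurable_cosM.
- by apply: measurable_funM => //; exact: measurable_cosM.
- by move=> x x0; apply: cvgM; [exact: Ff|exact: cvg_cst].
- by move=> n x; apply: le_trans (Fg n x); exact/normM_le1/abs_cos_le1.
Qed.

Lemma midlogconvex_tail_bounded_cvg (F : (R -> R)^nat) (f g : R -> R) :
  (forall n, measurable_fun [set: R] (F n)) -> measurable_fun [set: R] f ->
  (forall x : R, x != 0 -> F n x @[n --> \oo] --> f x) ->
  leb.-integrable [set: R] (EFin \o g) ->
  (forall n x, `|F n x| <= g x) ->
  (forall n, midlogconvex (F n) /\ tail_bounded (F n)) ->
  midlogconvex f /\ tail_bounded f.
Proof.
move=> mF mf Ff ig Fg HF.
have c v : cosint (F n) v @[n --> \oo] --> cosint f v.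
  exact: (@cosint_dominated_cvg F f g v).
split=> [v w vw|v v0].
  apply: (@ler_cvg_to _ \oo _ _ (fun n => cosint (F n) w ^+ 2)
    (fun n => cosint (F n) 0 * cosint (F n) v)).
  - by apply: cvgM; exact: c.
  - by apply: cvgM; exact: c.
  - by apply: nearW => n; exact: (HF n).1.
apply: (@ler_cvg_to _ \oo _ _ (fun n => `|v| * cosint (F n) v)
    (fun n => 64 * Num.sqrt pi * (1 - F n v^-1))).
- by apply: cvgM; [exact: cvg_cst|exact: c].
- apply: cvgM; first exact: cvg_cst.
  apply: cvgB; first exact: cvg_cst.
  by apply: Ff; rewrite invr_eq0.
- by apply: nearW => n; exact: (HF n).2.
Qed.

End mixtures.

(** * Binomial series *)

Lemma ge0_derive_le (R : realType) (F dF : R -> R) (a b : R) : a <= b ->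
  (forall x, a <= x <= b -> is_derive x 1 F (dF x)) ->
  (forall x, a < x < b -> 0 <= dF x) -> F a <= F b.
Proof.
move=> ab HF dF0.
have [->|anb] := eqVneq a b; first by [].
have ab' : a < b by rewrite lt_neqAle anb.
have dF' x : x \in `]a, b[ -> is_derive x 1 F (dF x).
  by rewrite in_itv/= => /andP[ax xb]; apply: HF; rewrite !ltW.
have cF : {within `[a, b], continuous F}.
  apply: derivable_within_continuous => x; rewrite in_itv/= => xab.
  by have [] := HF x xab.
have [c] := MVT ab' dF' cF.
by rewrite in_itv/= => cab E; rewrite -subr_ge0 E mulr_ge0 ?dF0// subr_ge0.
Qed.

Section binomial_series.
Context {R : realType}.
Variable a : R.
Hypotheses (a0 : 0 < a) (a1 : a < 1).

(* [bincoef n] is the coefficient of [y ^+ n.+1] in [1 - (1 - y) `^ a]. *)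
Fixpoint bincoef (n : nat) : R :=
  if n is m.+1 then bincoef m * ((m.+1%:R - a) / m.+2%:R) else a.

Definition binpoly (N : nat) : {poly R} :=
  \sum_(k < N) (bincoef k *: 'X^(k.+1)).

Lemma bincoef_ge0 n : 0 <= bincoef n.
Proof.
elim: n => [|n ih] /=; first exact: ltW.
rewrite mulr_ge0// divr_ge0// subr_ge0 (le_trans (ltW a1))//.
by rewrite ler1n.
Qed.

Lemma bincoefS n : n.+2%:R * bincoef n.+1 = (n.+1%:R - a) * bincoef n.
Proof. by rewrite /= mulrCA [X in _ * X]mulrC divfK ?pnatr_eq0// mulrC. Qed.

Lemma bincoef_le n : n.+1%:R * bincoef n <= a.
Proof.
elim: n => [|n ih]; first by rewrite mul1r.
apply: le_trans ih; rewrite bincoefS ler_wpM2r ?bincoef_ge0//.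
by rewrite gerBl ltW.
Qed.

Lemma horner_binpoly N y : (binpoly N).[y] = \sum_(k < N) bincoef k * y ^+ k.+1.
Proof. by rewrite horner_sum; apply: eq_bigr => k _; rewrite !hornerE. Qed.

Definition dbin (N : nat) (y : R) := \sum_(k < N) k.+1%:R * bincoef k * y ^+ k.

Lemma is_derive_binpoly N (y : R) :
  is_derive y 1 (horner (binpoly N)) (dbin N y).
Proof.
apply: is_derive_eq; rewrite /binpoly linear_sum horner_sum.
apply: eq_bigr => k _.
by rewrite /= derivZ derivXn hornerZ hornerMn hornerXn -mulr_natl mulrCA mulrA.
Qed.

(** The full series B = 1 - (1 - y)^a satisfies (1 - y) B' = a (1 - B). Truncation leaves a single
    defect term, because the recurrence [bincoefS] cancels all the others. *)
Lemma dbinE N (y : R) : (1 - y) * dbin N y =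
  a * (1 - (binpoly N).[y]) - N.+1%:R * bincoef N * y ^+ N.
Proof.
elim: N => [|N ih].
  by rewrite /dbin horner_binpoly !big_ord0 /= expr0; ring.
rewrite horner_binpoly /dbin !big_ord_recr/= -horner_binpoly -/(dbin N y).
rewrite mulrDr ih -/(bincoef N.+1) bincoefS exprS; ring.
Qed.

Lemma horner_binpoly_ge0 N (y : R) : 0 <= y -> 0 <= (binpoly N).[y].
Proof.
move=> y0; rewrite horner_binpoly; apply: sumr_ge0 => k _.
by rewrite mulr_ge0 ?bincoef_ge0// exprn_ge0.
Qed.

(** By monotonicity y = 1 is the worst case; there the left side of [dbinE] vanishes, and a (1 -
    P(1)) equals the nonnegative defect. *)
Lemma horner_binpoly_le1 N (y : R) : 0 <= y <= 1 -> (binpoly N).[y] <= 1.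
Proof.
move=> /andP[y0 y1]; apply: (@le_trans _ _ (binpoly N).[1]).
  rewrite !horner_binpoly; apply: ler_sum => k _.
  by rewrite ler_wpM2l ?bincoef_ge0// expr1n exprn_ile1.
have := dbinE N 1; rewrite subrr mul0r expr1n mulr1 => /esym/eqP.
rewrite subr_eq0 => /eqP E.
by rewrite -subr_ge0 -(pmulr_rge0 _ a0) E mulr_ge0 ?bincoef_ge0.
Qed.

(** For the full series this quotient is constantly 1. For the truncation only the defect term of
    [dbinE] drives it, so on [0, 1[ it starts at 1 and increases slowly; this yields both sides of
    [binpoly_bounds]. *)
Lemma is_derive_bin_quotient N (y : R) : y < 1 ->
  is_derive y 1 (fun x => (1 - (binpoly N).[x]) * (1 - x) `^ (- a))
    ((1 - y) `^ (- a - 1) * (N.+1%:R * bincoef N * y ^+ N)).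
Proof.
move=> y1.
have y1' : 0 < 1 - y by rewrite subr_gt0.
have d1 := is_derive_binpoly N y.
have d2 : is_derive y 1 (fun x : R => (1 - x) `^ (- a)) (a * (1 - y) `^ (- a -
  1)).
  have d3 : is_derive y 1 (fun x : R => 1 - x) (-1).
    by apply: is_derive_eq; ring.
  have d4 := is_derive1_powR (- a) y1'.
  have := @is_derive1_comp _ (@powR R ^~ (- a)) (fun x : R => 1 - x) y _ _ d4
    d3.
  by move=> d5; apply: (@is_derive_eq _ _ _ _ _ _ _ _ d5); ring.
apply: is_derive_eq; rewrite /GRing.scale/=.
have -> : (1 - y) `^ (- a) = (1 - y) * (1 - y) `^ (- a - 1).
  by rewrite -[X in X * _]powRr1 ?ltW// -powRD ?(gt_eqF y1') ?implybT//;
    congr (_ `^ _); ring.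
have := dbinE N y; move: (dbin N y) => D E.
transitivity ((1 - y) `^ (- a - 1) * (a * (1 - (binpoly N).[y]) - (1 - y) * D)).
  by ring.
by rewrite E; congr (_ * _); ring.
Qed.

Lemma binpoly_bounds N (y : R) : 0 <= y < 1 ->
  (1 - y) `^ a <= 1 - (binpoly N).[y] <= (1 - y) `^ a + a / (1 - y) * y ^+ N.
Proof.
move=> /andP[y0 y1].
have y1' : 0 < 1 - y by rewrite subr_gt0.
pose u x := (1 - (binpoly N).[x]) * (1 - x) `^ (- a).
have u0 : u 0 = 1.
  rewrite /u horner_binpoly big1 => [|k _]; last by rewrite expr0n/= mulr0.
  by rewrite !subr0 powR1 mulr1.
have uy : 1 - (binpoly N).[y] = u y * (1 - y) `^ a.
  by rewrite /u -mulrA -powRD ?addNr ?powRr0 ?mulr1// (gt_eqF y1') implybT.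
have p0 : 0 < (1 - y) `^ a by exact: powR_gt0.
have cN : 0 <= N.+1%:R * bincoef N by rewrite mulr_ge0 ?bincoef_ge0.
apply/andP; split.
  rewrite uy ler_peMl ?(ltW p0)// -u0.
  apply: (@ge0_derive_le R u (fun x => (1 - x) `^ (- a - 1) *
      (N.+1%:R * bincoef N * x ^+ N)) 0 y y0).
    by move=> x /andP[x0 xy]; apply: is_derive_bin_quotient;
      exact: le_lt_trans y1.
  move=> x /andP[x0 xy]; rewrite mulr_ge0 ?powR_ge0// mulr_ge0//.
  by rewrite exprn_ge0// ltW.
(* Upper bound for the derivative of [u] on [0, y], from (N + 1) [bincoef N] <= a and the
   monotonicity of both powers; multiplied by (1 - y)^a it becomes the error term a / (1 - y)
   y^N. *)
pose B := (1 - y) `^ (- a - 1) * (a * y ^+ N).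
have : B * 0 - u 0 <= B * y - u y.
  apply: (@ge0_derive_le R (fun x => B * x - u x) (fun x => B - (1 - x) `^ (- a
    - 1) * (N.+1%:R * bincoef N * x ^+ N)) 0 y y0).
    move=> x /andP[x0 xy].
    have := @is_derive_bin_quotient N x (le_lt_trans xy y1) => d.
    by apply: is_derive_eq; rewrite /GRing.scale/= mulr1 ?addr0 ?mulr0 ?add0r.
  move=> x /andP[/ltW x0 /ltW xy]; rewrite subr_ge0 /B.
  rewrite ler_pM ?powR_ge0 ?mulr_ge0 ?exprn_ge0 ?bincoef_ge0//.
    rewrite (_ : - a - 1 = - (a + 1)); last by ring.
    rewrite !powRN lef_pV2 ?posrE ?powR_gt0// ?subr_gt0 ?(le_lt_trans xy)//.
    by rewrite ge0_ler_powR ?nnegrE ?subr_ge0 ?(ltW y1) ?(le_trans xy (ltW y1))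
      ?addr_ge0 ?(ltW a0) ?lerD2l ?lerN2.
  by rewrite ler_pM ?exprn_ge0 ?bincoef_le// lerXn2r// nnegrE.
rewrite mulr0 sub0r u0 => H.
have {H} uyB : u y <= 1 + B * y by lra.
have B0 : 0 <= B by rewrite mulr_ge0 ?powR_ge0// mulr_ge0 ?exprn_ge0// ltW.
have {}uyB : u y <= 1 + B by apply: (le_trans uyB); rewrite lerD2l ler_piMr//
  ltW.
rewrite uy (le_trans (ler_wpM2r (ltW p0) uyB))// mulrDl mul1r lerD2l /B.
rewrite mulrAC -powRD ?(gt_eqF y1') ?implybT//.
rewrite (_ : - a - 1 + a = - 1); last by ring.
by rewrite (powR_inv1 (ltW y1')) mulrA (mulrC _ a).
Qed.

Lemma binpoly_cvg (y : R) : 0 <= y < 1 ->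
  (binpoly N).[y] @[N --> \oo] --> 1 - (1 - y) `^ a.
Proof.
move=> y01; have /andP[y0 y1] := y01.
apply: (@squeeze_cvgr _ _ _ _ (fun N => 1 - (1 - y) `^ a - a / (1 - y) * y ^+ N)
  (cst (1 - (1 - y) `^ a))).
- by apply: nearW => N; have := binpoly_bounds N y01; rewrite /cst; lra.
- rewrite -[X in _ --> X]subr0; apply: cvgB; first exact: cvg_cst.
  rewrite -(mulr0 (a / (1 - y))); apply: cvgM; first exact: cvg_cst.
  by apply: cvg_expr; rewrite ger0_norm.
- exact: cvg_cst.
Qed.

Lemma binpolyX_nneg N n i : 0 <= (binpoly N ^+ n)`_i.
Proof.
elim: n i => [|n ih] i; first by rewrite expr0 coef1.
rewrite exprS coefM; apply: sumr_ge0 => j _; rewrite mulr_ge0//.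
rewrite coef_sum; apply: sumr_ge0 => k _.
by rewrite coefZ coefXn mulr_ge0 ?bincoef_ge0.
Qed.

End binomial_series.

(** * Stable characteristic functions as limits of mixtures *)

Section stable.
Context {R : realType}.
Notation leb := (@lebesgue_measure R).

Lemma gauss_le1 (s x : R) : 0 <= s -> gauss s x <= 1.
Proof. by move=> s0; rewrite /gauss expR_le1 oppr_le0 mulr_ge0// sqr_ge0. Qed.

Lemma gauss_lt1 (s x : R) : 0 < s -> x != 0 -> gauss s x < 1.
Proof.
by move=> s0 x0; rewrite /gauss expR_lt1 oppr_lt0 mulr_gt0// exprn_even_gt0.
Qed.

Lemma measurable_gauss (s : R) : measurable_fun [set: R] (gauss s).
Proof. by apply: continuous_measurable_fun; exact: continuous_gauss. Qed.

(** Powers of a Gaussian are Gaussians, so this product is a mixture with parameters i d + e and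
    total mass [P.[1]]; e > 0 makes even the constant term of P a genuine Gaussian. *)
Lemma midlogconvex_tail_gauss_poly (P : {poly R}) (d e : R) : 0 <= d -> 0 < e ->
  (forall i, 0 <= P`_i) -> P.[1] <= 1 ->
  midlogconvex (fun x => P.[gauss d x] * gauss e x) /\
  tail_bounded (fun x => P.[gauss d x] * gauss e x).
Proof.
move=> d0 e0 P0 P1.
have -> : (fun x => P.[gauss d x] * gauss e x) =
    (fun x => \sum_(i < size P) P`_i * gauss (i%:R * d + e) x).
  apply/funext => x; rewrite horner_coef mulr_suml; apply: eq_bigr => i _.
  rewrite -mulrA; congr (_ * _); rewrite /gauss -expRM_natl -expRD.
  by congr expR; ring.
have s0 (i : nat) : 0 < i%:R * d + e by rewrite ltr_wpDl// mulr_ge0.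
split; first exact: (@midlogconvex_mix R _ (fun i => P`_i) (fun i => i%:R * d +
  e)).
apply: (@tail_bounded_mix R _ (fun i => P`_i) (fun i => i%:R * d + e)) => //.
move: P1; rewrite horner_coef.
by under eq_bigr do rewrite expr1n mulr1.
Qed.

Variable a : R.
Hypotheses (a0 : 0 < a) (a1 : a < 1).

Lemma midlogconvex_tail_binomial (n : nat) (d e : R) : 0 < d -> 0 < e ->
  let f := fun x => (1 - (1 - gauss d x) `^ a) ^+ n * gauss e x in
  midlogconvex f /\ tail_bounded f.
Proof.
move=> d0 e0 f.
pose P N := binpoly a N ^+ n.
have g01 x : 0 <= gauss d x <= 1 by rewrite gauss_ge0 gauss_le1// ltW.
apply: (@midlogconvex_tail_bounded_cvg R
    (fun N x => (P N).[gauss d x] * gauss e x) f (gauss e)).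
- move=> N; apply: measurable_funM; last exact: measurable_gauss.
  apply: continuous_measurable_fun => x; apply: continuous_comp.
    exact: continuous_gauss.
  exact: continuous_horner.
- apply: measurable_funM; last exact: measurable_gauss.
  apply: measurable_funX; apply: measurable_funB => //.
  apply: (measurableT_comp (measurable_powR _)).
  by apply: measurable_funB => //; exact: measurable_gauss.
- move=> x x0; apply: cvgM; last exact: cvg_cst.
  rewrite /P; under eq_fun do rewrite horner_exp.
  apply: (@continuous_cvg _ _ _ \oo _ (fun N => (binpoly a N).[gauss d x])
    (fun y => y ^+ n)); first exact: exprn_continuous.
  by apply: binpoly_cvg => //; rewrite gauss_ge0 gauss_lt1.
- exact: integrable_gauss.
- move=> N x; rewrite horner_exp normrM (ger0_norm (gauss_ge0 e x)).
  rewrite ler_piMl ?gauss_ge0// ger0_norm ?exprn_ge0 ?(horner_binpoly_ge0 a0 a1)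
    ?gauss_ge0//.
  by apply: exprn_ile1; [exact: horner_binpoly_ge0 (gauss_ge0 d x)|exact:
    horner_binpoly_le1].
- move=> N; apply: midlogconvex_tail_gauss_poly => //; first exact: ltW.
  + by move=> i; exact: binpolyX_nneg.
  + by rewrite horner_exp exprn_ile1 ?(horner_binpoly_ge0 a0 a1)
    ?(horner_binpoly_le1 a0 a1) ?ler01 ?lexx.
Qed.

Lemma cvg_expR_harmonic (c b : R) :
  expR (- (c / (1 + b * harmonic n))) @[n --> \oo] --> expR (- c).
Proof.
rewrite -[X in expR (- X)]divr1.
apply: (@continuous_cvg _ _ _ \oo _ (fun n => - (c /
  (1 + b * harmonic n))) expR).
  exact: continuous_expR.
apply: cvgN; apply: cvgM; first exact: cvg_cst.
apply: cvgV; first exact: oner_neq0.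
rewrite -[X in _ --> X]addr0; apply: cvgD; first exact: cvg_cst.
rewrite -(mulr0 b); apply: cvgM; first exact: cvg_cst.
exact: cvg_harmonic.
Qed.

Variable lam : R.
Hypothesis lam0 : 0 < lam.

Definition stable (x : R) := expR (- (lam * (x ^+ 2) `^ a)).

Lemma stable_ge0 x : 0 <= stable x. Proof. exact: expR_ge0. Qed.

Lemma measurable_stable : measurable_fun [set: R] stable.
Proof.
apply: measurableT_comp => //; apply: measurableT_comp => //.
apply: measurable_funM => //.
by apply: (measurableT_comp (measurable_powR _)); exact: measurable_funX.
Qed.

Let scale (n : nat) : R := (lam / n.+1%:R) `^ a^-1.

Let scale_gt0 n : 0 < scale n.
Proof. by rewrite powR_gt0// divr_gt0. Qed.

Let scaleX n : scale n `^ a = lam / n.+1%:R.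
Proof.
by rewrite -powRrM mulVf ?gt_eqF// powRr1// divr_ge0// ltW.
Qed.

Let scale_le n : scale n <= lam `^ a^-1 * harmonic n.
Proof.
rewrite /scale powRM ?invr_ge0 ?(ltW lam0)// ler_wpM2l ?powR_ge0//.
rewrite ge1r_powR//; first by rewrite invr_gt0 ltr0n invf_le1// ler1n.
by rewrite invf_ge1// ltW.
Qed.

(** With t = [scale n] x^2 one has t^a = lam X / (n + 1), and 1 - exp (- t) lies between t / (1 + t)
    and t. Hence (n + 1) z lies between lam X / (1 + t) and lam X, and exp (- z / (1 - z)) <= 1 - z
    <= exp (- z) squeezes the power. *)
Let expR_limit (x : R) : x != 0 ->
  (1 - (1 - gauss (scale n) x) `^ a) ^+ n.+1 @[n --> \oo] --> stable x.
Proof.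
move=> x0; set X := (x ^+ 2) `^ a.
have x20 : 0 < x ^+ 2 by rewrite exprn_even_gt0.
have X0 : 0 < X by rewrite powR_gt0.
have lX : 0 < lam * X by rewrite mulr_gt0.
pose t n := scale n * x ^+ 2.
have t0 n : 0 < t n by rewrite mulr_gt0.
have tX n : t n `^ a = lam * X / n.+1%:R.
  by rewrite /t powRM ?(ltW x20) ?(ltW (scale_gt0 n))// scaleX mulrAC.
pose z n := (1 - gauss (scale n) x) `^ a.
have g_lt1 n : 0 < 1 - gauss (scale n) x by rewrite subr_gt0 gauss_lt1.
have z0 n : 0 < z n by rewrite powR_gt0.
have zle n : z n <= lam * X / n.+1%:R.
  rewrite -tX ge0_ler_powR ?nnegrE ?(ltW (t0 n)) ?(ltW (g_lt1 n)) ?(ltW a0)//.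
  have := expR_ge1Dx (- t n); rewrite /gauss -/(t n); lra.
have zge n : lam * X / (1 + t n) <= n.+1%:R * z n.
  have t1 : 0 < 1 + t n by have := t0 n; lra.
  rewrite -ler_pdivrMl// mulrCA mulrA -tX.
  apply: (@le_trans _ _ ((t n / (1 + t n)) `^ a)).
    rewrite powRM ?invr_ge0 ?(ltW (t0 n)) ?(ltW t1)// ler_wpM2l ?powR_ge0//.
    have : 0 < (1 + t n)^-1 <= 1.
      by rewrite invr_gt0 t1 invf_le1//; have := t0 n; lra.
    by move=> h; apply: ger1_powR => //; exact: ltW.
  rewrite ge0_ler_powR ?nnegrE ?(ltW (g_lt1 n)) ?(ltW a0)//.
    by rewrite divr_ge0 ?(ltW (t0 n)) ?(ltW t1).
  have : gauss (scale n) x <= (1 + t n)^-1.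
    by rewrite /gauss expRN lef_pV2 ?posrE ?expR_gt0 ?expR_ge1Dx.
  have -> : t n / (1 + t n) = 1 - (1 + t n)^-1 by field; rewrite gt_eqF.
  lra.
apply: (@squeeze_cvgr _ _ _ _
    (fun n => expR (- (lam * X / (1 + - (lam * X) * harmonic n))))
    (fun n => expR (- (lam * X / (1 + lam `^ a^-1 * x ^+ 2 * harmonic n))))).
- near=> n.
  (* Only such n guarantee z < 1, on which the lower bound exp (- z / (1 - z)) depends. *)
  have n1 : lam * X < n.+1%:R.
    near: n; exists (Num.truncn (lam * X)) => // n /= hn.
    by apply: lt_le_trans (truncnS_gt _) _; rewrite ler_nat ltnS.
  have h1 : lam * X / n.+1%:R < 1 by rewrite ltr_pdivrMr ?mul1r.
  have z1 : z n < 1 by exact: le_lt_trans h1.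
  rewrite -/(z n); apply/andP; split.
    apply: (@le_trans _ _ (expR (- (z n / (1 - z n))) ^+ n.+1)).
      rewrite -expRM_natl ler_expR mulrN lerN2.
      rewrite mulrA ler_pM//.
      + by rewrite mulr_ge0// ltW.
      + by rewrite invr_ge0 subr_ge0 ltW.
      + by rewrite mulrC -ler_pdivlMr.
      + rewrite lef_pV2 ?posrE ?subr_gt0//; last first.
          by rewrite mulNr subr_gt0.
        by rewrite mulNr lerD2l lerN2.
    rewrite lerXn2r// ?nnegrE ?expR_ge0 ?subr_ge0 ?(ltW z1)//.
    rewrite expRN -[leRHS]invrK lef_pV2 ?posrE ?expR_gt0 ?invr_gt0 ?subr_gt0//.
    apply: le_trans (expR_ge1Dx _).
    by rewrite le_eqVlt; apply/orP; left; apply/eqP; field; lra.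
  apply: (@le_trans _ _ (expR (- z n) ^+ n.+1)).
    rewrite lerXn2r// ?nnegrE ?expR_ge0 ?subr_ge0 ?(ltW z1)//.
    exact: expR_ge1Dx.
  rewrite -expRM_natl ler_expR mulrN lerN2.
  apply: le_trans (zge n); rewrite ler_pM2l// lef_pV2 ?posrE.
  + rewrite lerD2l /t mulrAC ler_wpM2r ?scale_le// ltW//.
  + rewrite ltr_pwDl// mulr_ge0 ?invr_ge0// mulr_ge0 ?(ltW x20)//.
    exact: powR_ge0.
  + by rewrite addr_gt0.
- exact: cvg_expR_harmonic.
- exact: cvg_expR_harmonic.
Unshelve. all: end_near. Qed.

Let midlogconvex_tail_stable_gauss (e : R) : 0 < e ->
  midlogconvex (fun x => stable x * gauss e x) /\
  tail_bounded (fun x => stable x * gauss e x).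
Proof.
move=> e0.
apply: (@midlogconvex_tail_bounded_cvg R
  (fun n x => (1 - (1 - gauss (scale n) x) `^ a) ^+ n.+1 * gauss e x) _ (gauss
    e)).
- move=> n; apply: measurable_funM; last exact: measurable_gauss.
  apply: measurable_funX; apply: measurable_funB => //.
  apply: (measurableT_comp (measurable_powR _)).
  by apply: measurable_funB => //; exact: measurable_gauss.
- by apply: measurable_funM; [exact: measurable_stable|exact: measurable_gauss].
- by move=> x x0; apply: cvgM; [exact: expR_limit|exact: cvg_cst].
- exact: integrable_gauss.
- move=> n x; rewrite normrM (ger0_norm (gauss_ge0 e x)).
  rewrite ler_piMl ?gauss_ge0// normrX exprn_ile1//.
  have g1 : 0 <= 1 - gauss (scale n) x <= 1.
    by rewrite subr_ge0 gauss_le1 ?(ltW (scale_gt0 n))//= gerBl gauss_ge0.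
  have := powR_ge0 (1 - gauss (scale n) x) a.
  have : (1 - gauss (scale n) x) `^ a <= 1.
    have /andP[g0 g1'] := g1.
    rewrite -[leRHS](congr1 (fun f => f a) (powR1 R)).
    by rewrite ge0_ler_powR ?nnegrE ?ler01 ?(ltW a0).
  by rewrite ler_norml; lra.
- by move=> n; exact: midlogconvex_tail_binomial.
Qed.

(** The auxiliary Gaussian is removed by letting its parameter, here 1 / (n + 1), tend to 0; the
    products are dominated by the stable function, hence the integrability hypothesis. *)
Lemma midlogconvex_tail_stable : leb.-integrable [set: R] (EFin \o stable) ->
  midlogconvex stable /\ tail_bounded stable.
Proof.
move=> ints.
apply: (@midlogconvex_tail_bounded_cvg R
  (fun n x => stable x * gauss (harmonic n) x) _ stable).
- by move=> n; apply: measurable_funM; [exact: measurable_stable|exact: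
  measurable_gauss].
- exact: measurable_stable.
- move=> x x0; rewrite -[X in _ --> X]mulr1.
  apply: cvgM; first exact: cvg_cst.
  have h : - (harmonic n * x ^+ 2) @[n --> \oo] --> (0 : R).
    rewrite -oppr0 -(mul0r (x ^+ 2)); apply: cvgN; apply: cvgM;
      last exact: cvg_cst.
    exact: cvg_harmonic.
  have := @continuous_cvg _ _ _ \oo _ _ expR 0 (@continuous_expR R 0) h.
  by rewrite expR0; apply.
- exact: ints.
- move=> n x; rewrite normrM (ger0_norm (stable_ge0 x)) (ger0_norm (gauss_ge0 _
  x)).
  by apply: ler_piMr; [exact: stable_ge0|apply: gauss_le1; rewrite invr_ge0].
- by move=> n; apply: midlogconvex_tail_stable_gauss; rewrite invr_gt0.
Qed.

End stable.

(** * The stable density *)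

Section stable_density.
Context {R : realType}.
Notation leb := (@lebesgue_measure R).

Lemma integrable_oneDsqrV :
  leb.-integrable [set: R] (EFin \o (fun x => (oneDsqr x)^-1)).
Proof.
have c : continuous (fun x : R => (oneDsqr x)^-1) by exact: continuous_oneDsqrV.
have ge0 (x : R) : 0 <= (oneDsqr x)^-1 by rewrite invr_ge0 (le_trans ler01)//
  oneDsqr_ge1.
have m : measurable_fun [set: R] (EFin \o (fun x : R => (oneDsqr x)^-1)).
  by apply/measurable_EFinP; exact: continuous_measurable_fun.
apply/integrableP; split; first exact: m.
apply/abse_integralP => //=.
have -> : (\int[leb]_x ((oneDsqr x)^-1)%:E = 2%:E * (pi / 2)%:E)%E.
  rewrite ge0_symfun_integralT//.
    rewrite (_ : [set x | _] = `[0, +oo[%classic); last first.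
      by apply/seteqP; split => x/=; rewrite in_itv/= andbT.
    by rewrite integral0y_oneDsqr.
  by move=> x /=; rewrite /oneDsqr sqrrN.
by rewrite -EFinM ltry.
Qed.

Variable alpha : R.
Hypotheses (alpha0 : 0 < alpha) (alpha2 : alpha < 2).

Let st := stable (alpha / 2) alpha^-1.

Lemma sqr_powR_half (x : R) : (x ^+ 2) `^ (alpha / 2) = `|x| `^ alpha.
Proof.
rewrite -real_normK ?num_real// -powR_mulrn// -powRrM; congr (_ `^ _).
by field.
Qed.

Lemma stableE (x : R) : st x = expR (- (`|x| `^ alpha / alpha)).
Proof. by rewrite /st /stable sqr_powR_half mulrC. Qed.

(** Domination by C / (1 + x^2). The integer n is such that alpha (n + 1) >= 2; for |x| > 1 this
    gives x^2 <= (alpha t)^(n+1) <= alpha^(n+1) (n+1)! exp t. The summand 2 of [C] covers |x| <=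
    1. *)
Lemma integrable_stable : leb.-integrable [set: R] (EFin \o st).
Proof.
pose n := Num.truncn (2 / alpha).
have an : 2 <= alpha * n.+1%:R.
  by rewrite mulrC -ler_pdivrMr// ltW// truncnS_gt.
pose C : R := 2 + alpha ^+ n.+1 * n.+1`!%:R.
have /(integrableZl measurableT C) := integrable_oneDsqrV.
apply: (@integrable_ler _ _ (fun x => C * (oneDsqr x)^-1)).
  exact: measurable_stable.
move=> x; rewrite ger0_norm ?stable_ge0// ler_pdivlMr; last first.
  by rewrite (lt_le_trans ltr01)// oneDsqr_ge1.
rewrite stableE expRN mulrC ler_pdivrMr ?expR_gt0//.
set t := _ / alpha.
have t0 : 0 <= t by rewrite divr_ge0 ?powR_ge0// ltW.
have e1 : 1 <= expR t by rewrite -expR0 ler_expR.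
have D0 : 0 <= alpha ^+ n.+1 * n.+1`!%:R * expR t.
  by rewrite !mulr_ge0 ?expR_ge0// exprn_ge0// ltW.
rewrite /C mulrDl /oneDsqr -real_normK ?num_real//.
have [x1|x1] := leP `|x| 1.
  have : `|x| ^+ 2 <= 1 by rewrite exprn_ile1.
  by lra.
suff : `|x| ^+ 2 <= alpha ^+ n.+1 * n.+1`!%:R * expR t by lra.
apply: (@le_trans _ _ (`|x| `^ (alpha * n.+1%:R))).
  by rewrite -powR_mulrn// ler_powR// ltW.
have -> : `|x| `^ (alpha * n.+1%:R) = alpha ^+ n.+1 * t ^+ n.+1.
  rewrite powRrM powR_mulrn ?powR_ge0// -exprMn; congr (_ ^+ _).
  by rewrite /t mulrC divfK// gt_eqF.
rewrite -mulrA ler_wpM2l ?exprn_ge0 ?(ltW alpha0)//.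
have h := expR_ge1Dxn n t0.
have f0 : 0 < (n.+1`!%:R : R) by rewrite ltr0n fact_gt0.
rewrite [leRHS]mulrC -ler_pdivrMr//; apply: le_trans h; by rewrite lerDr.
Qed.

Lemma mu_cosint (v : R) : mu alpha v = (2 * pi)^-1 * cosint st v.
Proof.
rewrite /mu /mu_complex /Cintegral.
under eq_Rintegral do rewrite cexp_itE /=.
simpc; congr (_ * _).
by apply: eq_Rintegral => x _; rewrite stableE.
Qed.

Lemma cosint_stable0_gt0 : 0 < cosint st 0.
Proof.
apply: (@lt_le_trans _ _ (\int[leb]_x (st 1 * \1_`[0%R, 1%R] x))).
  rewrite RintegralZl//; last exact: integrable_indic_itv.
  rewrite mulr_gt0 ?expR_gt0//.
  rewrite /Rintegral integral_indic//= setIT lebesgue_measure_itv/= lte01.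
  by rewrite oppr0 addr0.
apply: le_Rintegral => //.
- have /(integrableZl measurableT (st 1)) := @integrable_indic_itv R 0 1 true
  false.
  exact.
- exact/integrable_Mcos/integrable_stable.
- move=> x _; rewrite mul0r cos0 mulr1 indicE.
  case: (boolP (x \in _)) => [|_]; last by rewrite mulr0 stable_ge0.
  rewrite inE/= in_itv/= => /andP[x0 x1]; rewrite mulr1 !stableE ler_expR lerN2.
  rewrite ler_pM2r ?invr_gt0// normr1 ger0_norm//.
  by rewrite ge0_ler_powR ?nnegrE// ltW.
Qed.

Lemma continuous_cosint_stable0 : {for 0, continuous (cosint st)}.
Proof.
pose f (l x : R) := st x * cos (l * x).
apply: (@continuity_under_integral R _ _ leb f [set: R] measurableT (-1) 1 _ _
  st).
- by move=> l _; exact/integrable_Mcos/integrable_stable.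
- apply: aeW => x _ l _; apply: cvgM; first exact: cvg_cst.
  under eq_fun do rewrite mulrC.
  by rewrite [l * x]mulrC; exact: (@continuous_cosM R x l).
- exact: integrable_stable.
- move=> l _; apply: aeW => x _; rewrite /f.
  rewrite (le_trans (normM_le1 _ (abs_cos_le1 _)))//.
  by rewrite ger0_norm// stable_ge0.
- by rewrite inE/= in_itv/=; lra.
Qed.

Lemma cosint_stable_near0 : exists2 d : R, 0 < d &
  forall v, `|v| <= d -> cosint st 0 / 2 <= cosint st v.
Proof.
have c0 := cosint_stable0_gt0.
have /cvgrPdist_lt/(_ (cosint st 0 / 2) (divr_gt0 c0 (ltr0Sn _ _))) :=
  continuous_cosint_stable0.
move=> /nbhs_ballP[d /= d0 H]; exists (d / 2); first by rewrite divr_gt0.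
move=> v vd; have /H : ball 0 d v.
  by rewrite /ball/= sub0r normrN; apply: le_lt_trans vd _; lra.
by rewrite /= ltr_norml; lra.
Qed.

Lemma stable_inequalities : midlogconvex st /\ tail_bounded st.
Proof.
have [a0 a1] : 0 < alpha / 2 /\ alpha / 2 < 1 by rewrite divr_gt0//
  ltr_pdivrMr// mul1r.
by apply: (midlogconvex_tail_stable a0 a1 _ integrable_stable);
  rewrite invr_gt0.
Qed.

(** In g(u)^2 <= g(0) g(w) with w^2 = 2 u^2, positivity of g(u) forces that of g(w): each step
    doubles the range of w^2, starting from the neighbourhood of 0 given by continuity. *)
Lemma cosint_stable_gt0 v : 0 < cosint st v.
Proof.
have c0 := cosint_stable0_gt0.
have [d d0 Hd] := cosint_stable_near0.
have [logconv _] := stable_inequalities.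
have H (k : nat) : forall w : R, w ^+ 2 <= d ^+ 2 * 2 ^+ k -> 0 < cosint st w.
  elim: k => [|k ih] w wk.
    apply: lt_le_trans (Hd w _); first by rewrite divr_gt0.
    by rewrite -(ler_pXn2r (ltn0Sn 1))// ?nnegrE ?(ltW d0)//
      real_normK ?num_real// -[leRHS]mulr1.
  pose u := w / Num.sqrt 2.
  have u2 : w ^+ 2 = 2 * u ^+ 2.
    by rewrite /u expr_div_n sqr_sqrtr// mulrC divfK.
  have u0 : 0 < cosint st u.
    by apply: ih; rewrite -(@ler_pM2l _ 2)// -u2 mulrCA -exprS.
  have := logconv _ _ u2.
  have : 0 < cosint st u ^+ 2 by rewrite exprn_gt0.
  by move=> h1 h2; rewrite -(pmulr_rgt0 _ c0); exact: lt_le_trans h2.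
pose k := Num.truncn (v ^+ 2 / d ^+ 2).
apply: (H k); rewrite mulrC -ler_pdivrMr ?exprn_gt0// ltW//.
apply: lt_le_trans (truncnS_gt _) _.
by rewrite -natrX ler_nat ltn_expl.
Qed.

Lemma mu_gt0 v : 0 < mu alpha v.
Proof.
by rewrite mu_cosint mulr_gt0 ?cosint_stable_gt0// invr_gt0 mulr_gt0// pi_gt0.
Qed.

Lemma mu_near0 : exists d c : R, [/\ 0 < d, 0 < c &
  forall v, `|v| <= d -> c <= mu alpha v].
Proof.
have [d d0 Hd] := cosint_stable_near0.
have p0 : 0 < (2 * pi)^-1 :> R by rewrite invr_gt0 mulr_gt0// pi_gt0.
exists d, ((2 * pi)^-1 * (cosint st 0 / 2)); split => //.
  by rewrite mulr_gt0// divr_gt0// cosint_stable0_gt0.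
by move=> v /Hd h; rewrite mu_cosint ler_pM2l.
Qed.

(** In [tail_bounded], 1 - exp (- |v|^(-alpha) / alpha) <= |v|^(-alpha) / alpha; dividing by |v|
    gives the exponent. *)
Lemma mu_tail : exists2 C : R, 0 < C &
  forall v, v != 0 -> mu alpha v <= C * `|v| `^ (- (1 + alpha)).
Proof.
have p0 : 0 < (2 * pi)^-1 :> R by rewrite invr_gt0 mulr_gt0// pi_gt0.
exists ((2 * pi)^-1 * (64 * Num.sqrt pi / alpha)).
  by rewrite mulr_gt0// divr_gt0// mulr_gt0// sqrtr_gt0 pi_gt0.
move=> v v0; rewrite mu_cosint -[leRHS]mulrA ler_pM2l//.
have [_ /(_ v v0)] := stable_inequalities.
have v0' : 0 < `|v| by rewrite normr_gt0.
rewrite mulrC -ler_pdivlMr// => H; apply: (le_trans H).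
rewrite ler_pdivrMr// -!mulrA ler_pM2l// ler_pM2l ?sqrtr_gt0 ?pi_gt0//.
have -> : `|v| `^ (- (1 + alpha)) * `|v| = `|v^-1| `^ alpha.
  rewrite normfV -(powR_inv1 (ltW v0')) -powRrM -[X in _ * X](powRr1 (ltW v0')).
  rewrite -powRD ?(gt_eqF v0') ?implybT//.
  by congr (_ `^ _); ring.
rewrite stableE; have := expR_ge1Dx (- (`|v^-1| `^ alpha / alpha)).
rewrite (mulrC (alpha^-1)); lra.
Qed.

End stable_density.

(** * Lower bound on the weights *)

Section weights.
Context {R : realType}.
Implicit Types (t k : R).

(** Three integrations from 0 pass the sign of the third derivative down. It is applied to brackets
    of the weights whose stencil has been given a variable half-width x; the actual bracket is x =
    2. *)
Lemma triple_derive_ge0 (F0 F1 F2 F3 : R -> R) (b : R) : 0 <= b ->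
  (forall x, 0 <= x <= b -> is_derive x 1 F0 (F1 x)) ->
  (forall x, 0 <= x <= b -> is_derive x 1 F1 (F2 x)) ->
  (forall x, 0 <= x <= b -> is_derive x 1 F2 (F3 x)) ->
  F0 0 = 0 -> F1 0 = 0 -> F2 0 = 0 ->
  (forall x, 0 < x < b -> 0 <= F3 x) -> 0 <= F0 b.
Proof.
move=> b0 d0 d1 d2 F00 F10 F20 F3ge0.
have step (G dG : R -> R) :
    (forall x, 0 <= x <= b -> is_derive x 1 G (dG x)) -> G 0 = 0 ->
    (forall x, 0 < x < b -> 0 <= dG x) -> forall x, 0 <= x <= b -> 0 <= G x.
  move=> dGG G0 dG0 x /andP[x0 xb]; rewrite -[leLHS]G0.
  apply: (@ge0_derive_le R G dG 0 x x0).
    by move=> y /andP[y0 yx]; apply: dGG; rewrite y0 (le_trans yx).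
  by move=> y /andP[y0 yx]; apply: dG0; rewrite y0 (lt_le_trans yx).
have F2ge0 := step _ _ d2 F20 F3ge0.
have F1ge0 : forall x, 0 <= x <= b -> 0 <= F1 x.
  by apply: (step _ _ d1 F10) => x /andP[x0 xb]; apply: F2ge0; rewrite !ltW.
apply: (step _ _ d0 F00); last by rewrite b0 lexx.
by move=> x /andP[x0 xb]; apply: F1ge0; rewrite !ltW.
Qed.

Lemma is_derive_shiftD (f : R -> R) (k x d : R) : is_derive (k + x) 1 f d ->
  is_derive x 1 (fun y => f (k + y)) d.
Proof.
move=> df; have dk : is_derive x 1 (fun y : R => k + y) 1.
  by apply: is_derive_eq; ring.
rewrite -[d]mulr1.
exact: (@is_derive1_comp _ f (fun y => k + y) x _ _ df dk).
Qed.

Lemma is_derive_shiftB (f : R -> R) (k x d : R) : is_derive (k - x) 1 f d ->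
  is_derive x 1 (fun y => f (k - y)) (- d).
Proof.
move=> df; have dk : is_derive x 1 (fun y : R => k - y) (-1).
  by apply: is_derive_eq; ring.
rewrite -[- d]mulrN1.
exact: (@is_derive1_comp _ f (fun y => k - y) x _ _ df dk).
Qed.

(** * Derivatives of [phi] in closed form; the even weights and the first weight *)

Section primitives.
Variable alpha : R.
Hypotheses (alpha0 : 0 < alpha) (alpha2 : alpha < 2).

Definition phi1 t := if alpha == 1 then - ln t
  else t `^ (1 - alpha) / ((alpha - 1) * alpha).
Definition phi2 t := - (t `^ (- alpha) / alpha).
Definition phi3 t := t `^ (- alpha - 1).
Definition phi4 t := (- alpha - 1) * t `^ (- alpha - 2).

Lemma is_derive_phi t : 0 < t -> is_derive t 1 (phi alpha) (phi1 t).
Proof.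
move=> t0; rewrite /phi /phi1; case: eqVneq => [_|a1].
  have := is_derive1_ln t0 => dl; apply: is_derive_eq.
  by rewrite /GRing.scale/=; field; rewrite gt_eqF.
have := is_derive1_powR (2 - alpha) t0 => dp; apply: is_derive_eq.
rewrite /GRing.scale/= (_ : 2 - alpha - 1 = 1 - alpha); last by ring.
field; rewrite (gt_eqF alpha0) (_ : 2 - alpha != 0) ?subr_eq0 ?(gt_eqF
  alpha2)//=.
by rewrite a1.
Qed.

Lemma is_derive_phi1 t : 0 < t -> is_derive t 1 phi1 (phi2 t).
Proof.
move=> t0; rewrite /phi1 /phi2; case: eqVneq => [->|a1].
  have := is_derive1_ln t0 => dl; apply: is_derive_eq.
  by rewrite powR_inv1 ?ltW// divr1.
have := is_derive1_powR (1 - alpha) t0 => dp; apply: is_derive_eq.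
rewrite /GRing.scale/= (_ : 1 - alpha - 1 = - alpha); last by ring.
by field; rewrite (gt_eqF alpha0) subr_eq0 a1.
Qed.

Lemma is_derive_phi2 t : 0 < t -> is_derive t 1 phi2 (phi3 t).
Proof.
move=> t0; rewrite /phi2 /phi3.
have := is_derive1_powR (- alpha) t0 => dp; apply: is_derive_eq.
by rewrite /GRing.scale/=; field; rewrite (gt_eqF alpha0).
Qed.

Lemma is_derive_phi3 t : 0 < t -> is_derive t 1 phi3 (phi4 t).
Proof.
move=> t0; rewrite /phi3 /phi4.
have := is_derive1_powR (- alpha - 1) t0 => dp; apply: is_derive_eq.
by congr (_ * _ `^ _); ring.
Qed.

Lemma derive1_phi t : 0 < t -> derive1 (phi alpha) t = phi1 t.
Proof. by move=> t0; rewrite derive1E; have [] := is_derive_phi t0. Qed.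

Lemma derive1n2_phi t : 0 < t -> derive1n 2 (phi alpha) t = phi2 t.
Proof.
move=> t0; rewrite /= derive1E.
rewrite (@near_eq_derive _ _ _ _ phi1); last first.
  by near=> z; rewrite derive1_phi//; near: z; exact: lt_nbhsr.
by have [] := is_derive_phi1 t0.
Unshelve. all: end_near. Qed.

Lemma phi3_gt0 t : 0 < t -> 0 < phi3 t. Proof. exact: powR_gt0. Qed.

Lemma phi3_nincr t u : 0 < t -> t <= u -> phi3 u <= phi3 t.
Proof.
move=> t0 tu; rewrite /phi3 (_ : - alpha - 1 = - (alpha + 1)); last by ring.
have u0 : 0 < u by exact: lt_le_trans tu.
rewrite !powRN lef_pV2 ?posrE ?powR_gt0//.
have a1 : 0 <= alpha + 1 by rewrite addr_ge0// ltW.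
by rewrite ge0_ler_powR// nnegrE ltW.
Qed.

Lemma phi4_le0 t : phi4 t <= 0.
Proof. by rewrite mulr_le0_ge0 ?powR_ge0// -opprD oppr_le0 addr_ge0// ltW. Qed.

(** With a variable half-width x the bracket has derivative x (phi2 (k + x) - phi2 (k - x)). The
    difference is the integral of [phi3], at least x phi3 k since [phi3] is positive and
    nonincreasing; integrating x^2 over [0, 1] gives the factor 1/3. *)
Lemma even_weight_ge k : 2 <= k -> phi3 k / 3 <=
  phi1 (k + 1) + phi1 (k - 1) - phi alpha (k + 1) + phi alpha (k - 1).
Proof.
move=> k2.
pose F (x : R) := x * (phi1 (k + x) + phi1 (k - x)) - phi alpha (k + x)
  + phi alpha (k - x) - phi3 k / 3 * x ^+ 3.
pose G (x : R) := phi2 (k + x) - phi2 (k - x) - phi3 k * x.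
pose dG (x : R) := phi3 (k + x) + phi3 (k - x) - phi3 k.
have dG1 (x : R) : 0 <= x <= 1 -> is_derive x 1 G (dG x).
  move=> x01.
  have kp : 0 < k + x by lra.
  have km : 0 < k - x by lra.
  have d1 := is_derive_shiftD (is_derive_phi2 kp).
  have d2 := is_derive_shiftB (is_derive_phi2 km).
  rewrite /G /dG; apply: is_derive_eq; rewrite /GRing.scale/=; ring.
have dG0 (x : R) : 0 <= x <= 1 -> 0 <= dG x.
  move=> x01; rewrite /dG.
  have : phi3 k <= phi3 (k - x) by apply: phi3_nincr; lra.
  have : 0 < phi3 (k + x) by apply: phi3_gt0; lra.
  by lra.
have G0 (x : R) : 0 <= x <= 1 -> 0 <= G x.
  move=> x01; have -> : 0 = G 0 by rewrite /G addr0 subr0 subrr mulr0 subr0.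
  apply: (@ge0_derive_le R G dG); first by case/andP: x01.
    by move=> y y01; apply: dG1; lra.
  by move=> y y01; apply: dG0; lra.
have dF1 (x : R) : 0 <= x <= 1 -> is_derive x 1 F (x * G x).
  move=> x01.
  have kp : 0 < k + x by lra.
  have km : 0 < k - x by lra.
  have d1 := is_derive_shiftD (is_derive_phi1 kp).
  have d2 := is_derive_shiftB (is_derive_phi1 km).
  have d3 := is_derive_shiftD (is_derive_phi kp).
  have d4 := is_derive_shiftB (is_derive_phi km).
  by rewrite /F /G; apply: is_derive_eq; rewrite /GRing.scale/= ?expr2; field.
have : F 0 <= F 1.
  apply: (@ge0_derive_le R F (fun x => x * G x) 0 1 ler01).
  by move=> x x01; rewrite mulr_ge0 ?G0//; lra.
by rewrite /F addr0 subr0 mul0r expr0n/= mulr0 expr1n; lra.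
Qed.

(** On [1, 1 + x] the third derivative in x is phi3 / 4 - x phi4 / 4, nonnegative because [phi4] is
    nonpositive. The remaining term 1 / (2 - alpha) of the first weight then serves alone as its
    lower bound. *)
Lemma first_weight_ge0 : 0 <=
  - phi2 1 - (phi1 3 + 3 * phi1 1) / 2 + phi alpha 3 - phi alpha 1.
Proof.
pose F0 (x : R) := phi alpha (1 + x) - phi alpha 1 - x /
  4 * (phi1 (1 + x) + 3 * phi1 1)
  - x ^+ 2 / 4 * phi2 1.
pose F1 (x : R) := 3 / 4 * (phi1 (1 + x) - phi1 1) - x / 4 * phi2 (1 + x) - x /
  2 * phi2 1.
pose F2 (x : R) := phi2 (1 + x) / 2 - x / 4 * phi3 (1 + x) - phi2 1 / 2.
pose F3 (x : R) := phi3 (1 + x) / 4 - x / 4 * phi4 (1 + x).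
have d0 (x : R) : 0 <= x <= 2 -> is_derive x 1 (fun x => phi alpha (1 + x))
  (phi1 (1 + x)).
  move=> x02; have x1 : 0 < 1 + x by lra.
  exact: is_derive_shiftD (is_derive_phi x1).
have d1 (x : R) : 0 <= x <= 2 -> is_derive x 1 (fun x => phi1 (1 + x)) (phi2 (1
  + x)).
  move=> x02; have x1 : 0 < 1 + x by lra.
  exact: is_derive_shiftD (is_derive_phi1 x1).
have d2 (x : R) : 0 <= x <= 2 -> is_derive x 1 (fun x => phi2 (1 + x)) (phi3 (1
  + x)).
  move=> x02; have x1 : 0 < 1 + x by lra.
  exact: is_derive_shiftD (is_derive_phi2 x1).
have d3 (x : R) : 0 <= x <= 2 -> is_derive x 1 (fun x => phi3 (1 + x)) (phi4 (1
  + x)).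
  move=> x02; have x1 : 0 < 1 + x by lra.
  exact: is_derive_shiftD (is_derive_phi3 x1).
have := @triple_derive_ge0 F0 F1 F2 F3 2 (ler0n _ 2).
have -> : F0 2 = - phi2 1 - (phi1 3 + 3 * phi1 1) /
  2 + phi alpha 3 - phi alpha 1.
  rewrite /F0 (_ : 1 + 2 = 3 :> R); last by ring.
  by field.
apply.
- move=> x x02; have := d0 x x02; have := d1 x x02 => ? ?.
  by rewrite /F0 /F1; apply: is_derive_eq; rewrite /GRing.scale/=; field.
- move=> x x02; have := d1 x x02; have := d2 x x02 => ? ?.
  by rewrite /F1 /F2; apply: is_derive_eq; rewrite /GRing.scale/=; field.
- move=> x x02; have := d2 x x02; have := d3 x x02 => ? ?.
  by rewrite /F2 /F3; apply: is_derive_eq; rewrite /GRing.scale/=; field.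
- by rewrite /F0 addr0; ring.
- by rewrite /F1 addr0; ring.
- by rewrite /F2 addr0; ring.
- move=> x x02; rewrite /F3.
  have := @phi3_gt0 (1 + x); have := phi4_le0 (1 + x).
  have : 0 < 1 + x by lra.
  nra.
Qed.

End primitives.

(* Simpson-like functional of the odd weights; [oddJ0 2] is the bracket in
   [betah], and [oddJ1], [oddJ2], [oddJ3] are its successive derivatives in the
   half-width [x] of the stencil. *)
Section odd_functional.
Variables (p0 p1 p2 p3 p4 : R -> R) (k : R).
Hypothesis d0 : forall t, 0 < t -> is_derive t 1 p0 (p1 t).
Hypothesis d1 : forall t, 0 < t -> is_derive t 1 p1 (p2 t).
Hypothesis d2 : forall t, 0 < t -> is_derive t 1 p2 (p3 t).
Hypothesis d3 : forall t, 0 < t -> is_derive t 1 p3 (p4 t).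

Definition oddJ0 (x : R) :=
  p0 (k + x) - p0 (k - x) - x / 4 * (p1 (k + x) + p1 (k - x) + 6 * p1 k).
Definition oddJ1 (x : R) :=
  3 / 4 * (p1 (k + x) + p1 (k - x) - 2 * p1 k) - x /
    4 * (p2 (k + x) - p2 (k - x)).
Definition oddJ2 (x : R) :=
  (p2 (k + x) - p2 (k - x)) / 2 - x / 4 * (p3 (k + x) + p3 (k - x)).
Definition oddJ3 (x : R) :=
  (p3 (k + x) + p3 (k - x)) / 4 - x / 4 * (p4 (k + x) - p4 (k - x)).

Lemma is_derive_oddJ0 (x : R) : 0 <= x < k -> is_derive x 1 oddJ0 (oddJ1 x).
Proof.
move=> xk; have kp : 0 < k + x by lra.
have km : 0 < k - x by lra.
have ? := is_derive_shiftD (d0 kp); have ? := is_derive_shiftB (d0 km).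
have ? := is_derive_shiftD (d1 kp); have ? := is_derive_shiftB (d1 km).
by rewrite /oddJ0 /oddJ1; apply: is_derive_eq; rewrite /GRing.scale/=; field.
Qed.

Lemma is_derive_oddJ1 (x : R) : 0 <= x < k -> is_derive x 1 oddJ1 (oddJ2 x).
Proof.
move=> xk; have kp : 0 < k + x by lra.
have km : 0 < k - x by lra.
have ? := is_derive_shiftD (d1 kp); have ? := is_derive_shiftB (d1 km).
have ? := is_derive_shiftD (d2 kp); have ? := is_derive_shiftB (d2 km).
by rewrite /oddJ1 /oddJ2; apply: is_derive_eq; rewrite /GRing.scale/=; field.
Qed.

Lemma is_derive_oddJ2 (x : R) : 0 <= x < k -> is_derive x 1 oddJ2 (oddJ3 x).
Proof.
move=> xk; have kp : 0 < k + x by lra.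
have km : 0 < k - x by lra.
have ? := is_derive_shiftD (d2 kp); have ? := is_derive_shiftB (d2 km).
have ? := is_derive_shiftD (d3 kp); have ? := is_derive_shiftB (d3 km).
by rewrite /oddJ2 /oddJ3; apply: is_derive_eq; rewrite /GRing.scale/=; field.
Qed.

Lemma oddJ0_0 : oddJ0 0 = 0.
Proof. by rewrite /oddJ0 addr0 subr0; ring. Qed.

Lemma oddJ1_0 : oddJ1 0 = 0.
Proof. by rewrite /oddJ1 addr0 subr0; ring. Qed.

Lemma oddJ2_0 : oddJ2 0 = 0.
Proof. by rewrite /oddJ2 addr0 subr0; ring. Qed.

End odd_functional.

(** * Monotonicity of the normalized third derivative of the odd bracket *)

Definition powR_sum (r u : R) := (1 + u) `^ (- r) + (1 - u) `^ (- r).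

Lemma powR_sum_ge0 r u : 0 <= powR_sum r u.
Proof. by rewrite addr_ge0 ?powR_ge0. Qed.

(** Put b = 1 + u, c = 1 / (1 - u), e = s - r, so that 1 <= b <= c. The gain c^r (c^e - 1) in the
    second term is at least b^e - 1, hence at least the loss b^(-s) (b^e - 1) in the first. *)
Lemma ler_powR_sum r s u : 0 <= u < 1 -> 0 <= r <= s -> powR_sum r u <= powR_sum
  s u.
Proof.
move=> u01 rs; pose e := s - r; pose b := 1 + u; pose c := (1 - u)^-1.
have u1 : 0 < 1 - u by lra.
have b1 : 1 <= b by rewrite /b; lra.
have bc : b <= c by rewrite /c -[leRHS]mul1r ler_pdivlMr// /b;
  have := sqr_ge0 u; lra.
have c1 : 1 <= c by exact: le_trans bc.
have cr x : (1 - u) `^ (- x) = c `^ x.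
  by rewrite /c -(powR_inv1 (ltW u1)) -powRrM mulN1r.
have e0 : 0 <= e by rewrite subr_ge0; case/andP: rs.
have s0 : 0 <= s by case/andP: rs; exact: le_trans.
have r0 : 0 <= r by case/andP: rs.
have pge1 (x y : R) : 1 <= x -> 0 <= y -> 1 <= x `^ y.
  by move=> x1 y0; rewrite -(powRr0 x) ler_powR.
have E1 : c `^ s = c `^ r * c `^ e.
  by rewrite -powRD; [congr (_ `^ _); rewrite /e;
    ring|rewrite implybE (gt_eqF (lt_le_trans ltr01 c1)) ?orbT].
have E2 : b `^ (- r) = b `^ (- s) * b `^ e.
  by rewrite -powRD; [congr (_ `^ _); rewrite /e;
    ring|rewrite implybE (gt_eqF (lt_le_trans ltr01 b1)) ?orbT].
rewrite /powR_sum !cr -/b E1 E2.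
have h1 := pge1 _ _ c1 r0.
have h2 : b `^ e <= c `^ e by rewrite ge0_ler_powR ?nnegrE//; lra.
have h3 := pge1 _ _ b1 e0.
have h4 : b `^ (- s) <= 1 by rewrite powRN invf_le1 ?pge1// powR_gt0//; lra.
have h5 := powR_ge0 b (- s).
by nra.
Qed.

(** This is [oddJ3] after the scaling x = k u, freed of the factor k^(-1-alpha) / 4, with q = alpha
    + 2; see [oddJ3_phi]. *)
Definition oddN (q u : R) :=
  (1 + u) `^ (- q) * (1 + q * u) + (1 - u) `^ (- q) * (1 - q * u).

Lemma is_derive_oddN (q u : R) : 0 <= u < 1 ->
  is_derive u 1 (oddN q) (- (q * (q - 1) * u * powR_sum (q + 1) u)).
Proof.
move=> u01; have up : 0 < 1 + u by lra.
have um : 0 < 1 - u by lra.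
have d1 := is_derive_shiftD (is_derive1_powR (- q) up).
have d2 := is_derive_shiftB (is_derive1_powR (- q) um).
rewrite /oddN /powR_sum; apply: is_derive_eq; rewrite /GRing.scale/=.
have E (x : R) : 0 < x -> x `^ (- q) = x * x `^ (- (q + 1)).
  move=> x0; rewrite -[X in X * _]powRr1 ?ltW// -powRD ?(gt_eqF x0) ?implybT//.
  by congr (_ `^ _); ring.
rewrite (E _ up) (E _ um) (_ : - q - 1 = - (q + 1)); last by ring.
by ring.
Qed.

Lemma oddN_nincr (q u v : R) : 1 <= q -> 0 <= u <= v -> v < 1 ->
  oddN q v <= oddN q u.
Proof.
move=> q1 /andP[u0 uv] v1.
suff : - oddN q u <= - oddN q v by rewrite lerN2.
apply: (@ge0_derive_le R (fun x => - oddN q x)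
    (fun x => - (- (q * (q - 1) * x * powR_sum (q + 1) x))) u v uv).
  move=> x xuv; have x01 : 0 <= x < 1 by lra.
  have ? := @is_derive_oddN q x x01.
  by apply: is_derive_eq.
move=> x xuv; rewrite opprK mulr_ge0 ?powR_sum_ge0// mulr_ge0//; last lra.
by rewrite mulr_ge0//; lra.
Qed.

(** Both sides equal 2 at u = 0, and the rate of decrease q (q - 1) u [powR_sum (q + 1) u] grows
    with q. The extreme q = 4 corresponds to alpha = 2. *)
Lemma oddN_ge4 (q u : R) : 1 <= q <= 4 -> 0 <= u < 1 -> oddN 4 u <= oddN q u.
Proof.
move=> q14 u01; rewrite -subr_ge0.
have <- : oddN q 0 - oddN 4 0 = 0.
  by rewrite /oddN addr0 subr0 !powR1; ring.
have u0 : 0 <= u by case/andP: u01.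
apply: (@ge0_derive_le R (fun x => oddN q x - oddN 4 x)
  (fun x => - (q * (q - 1) * x * powR_sum (q + 1) x) -
            - (4 * (4 - 1) * x * powR_sum (4 + 1) x)) 0 u u0).
  move=> x x0u; have x01 : 0 <= x < 1 by lra.
  have ? := @is_derive_oddN q x x01; have ? := @is_derive_oddN 4 x x01.
  by apply: is_derive_eq.
move=> x x0u.
have : powR_sum (q + 1) x <= powR_sum (4 + 1) x by apply: ler_powR_sum; lra.
have := powR_sum_ge0 (q + 1) x.
move: (powR_sum (q + 1) x) (powR_sum (4 + 1) x) => A B A0 AB.
rewrite opprK addrC subr_ge0 ler_pM//.
- by rewrite !mulr_ge0//; lra.
- by rewrite ler_pM2r; [nra|lra].
Qed.

Lemma oddJ3_phi (alpha k x : R) : 0 < k -> 0 <= x < k ->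
  oddJ3 (phi3 alpha) (phi4 alpha) k x =
  k `^ (- alpha - 1) * oddN (alpha + 2) (x / k) / 4.
Proof.
move=> k0 xk; pose u := x / k.
have xu : x = k * u by rewrite mulrC divfK// gt_eqF.
have u01 : 0 <= u < 1 by rewrite divr_ge0 ?ltr_pdivrMr ?mul1r; lra.
have P (y e : R) : 0 <= y -> (k * y) `^ e = k `^ e * y `^ e.
  by move=> y0; rewrite powRM// ltW.
have E (y : R) : 0 < y -> y `^ (- alpha - 1) = y * y `^ (- (alpha + 2)).
  move=> y0; rewrite -[X in X * _]powRr1 ?ltW// -powRD ?(gt_eqF y0) ?implybT//.
  by congr (_ `^ _); ring.
have F : k `^ (- alpha - 1) = k * k `^ (- (alpha + 2)) by exact: E.
rewrite /oddJ3 /phi3 /phi4 /oddN -/u {1 2 3 4 5}xu.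
rewrite (_ : k + k * u = k * (1 + u)); last by ring.
rewrite (_ : k - k * u = k * (1 - u)); last by ring.
rewrite (_ : - alpha - 2 = - (alpha + 2)); last by ring.
have up : 0 < 1 + u by lra.
have um : 0 < 1 - u by lra.
rewrite !P ?(ltW up) ?(ltW um)// (E _ up) (E _ um) F.
by field.
Qed.

(** Partial sum of the series of ln ((1 + x) / (1 - x)) at x = 2/3, where the quotient is 5; the
    remainder has the nonnegative derivative 2 x^10 / (1 - x^2). *)
Lemma ln5_gt : 8 / 5 < ln (5 : R).
Proof.
pose F (x : R) := ln (1 + x) - ln (1 - x)
  - 2 * (x + x ^+ 3 / 3 + x ^+ 5 / 5 + x ^+ 7 / 7 + x ^+ 9 / 9).
have : F 0 <= F (2 / 3).
  apply: (@ge0_derive_le R F (fun x => 2 * x ^+ 10 / (1 - x ^+ 2))); first lra.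
    move=> x x01; have xp : 0 < 1 + x by lra.
    have xm : 0 < 1 - x by lra.
    have ? := is_derive_shiftD (is_derive1_ln xp).
    have ? := is_derive_shiftB (is_derive1_ln xm).
    rewrite /F; apply: is_derive_eq; rewrite /GRing.scale/=.
    by field; rewrite !gt_eqF//; nra.
  move=> x x01; have x0 : 0 <= x by lra.
  rewrite divr_ge0 ?mulr_ge0 ?exprn_ge0// subr_ge0 exprn_ile1//; lra.
rewrite {1}/F addr0 subr0 ln1 !expr0n/=.
have -> : F (2 / 3) = ln 5 - 2 * (2 / 3 + (2 / 3) ^+ 3 / 3 + (2 / 3) ^+ 5 / 5
    + (2 / 3) ^+ 7 / 7 + (2 / 3) ^+ 9 / 9).
  rewrite /F (_ : 1 + 2 / 3 = 5 / 3); last by field.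
  rewrite (_ : 1 - 2 / 3 = 3^-1); last by field.
  by rewrite lnM ?posrE ?invr_gt0// lnV ?posrE// opprK addrNK.
lra.
Qed.

Section odd.
Variable alpha : R.
Hypotheses (alpha0 : 0 < alpha) (alpha2 : alpha < 2).

(** The bracket times k^(1+alpha) is compared with its value at k = 3, alpha = 2, which is 27 [J 2].
    Both vanish to second order at half-width 0, so it suffices to compare third derivatives:
    [oddN 4] at x / 3 is at most [oddN (alpha + 2)] at x / 3, hence at the smaller argument x /
    k. *)
Lemma odd_weight_ge : exists2 c : R, 0 < c & forall k, 3 <= k ->
  c * phi3 alpha k <= - ((phi1 alpha (k + 2) + 6 * phi1 alpha k + phi1 alpha (k
    - 2)) / 2)
    + phi alpha (k + 2) - phi alpha (k - 2).
Proof.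
(* The denominator of [phi] contains 2 - alpha and vanishes at alpha = 2; this primitive of [phi1 2]
   takes the place of [phi 2]. *)
pose l t := ln t / 2 : R.
pose J := oddJ0 l (phi1 2) 3.
have two0 : 0 < (2 : R) by [].
have J2 : J 2 = ln 5 / 2 - 4 / 5.
  rewrite /J /oddJ0 /l /phi1 (_ : (2 == 1 :> R) = false); last first.
    by apply/negbTE; rewrite gt_eqF//; lra.
  rewrite (_ : 3 + 2 = 5); last by ring.
  rewrite (_ : 3 - 2 = 1); last by ring.
  rewrite (_ : 1 - 2 = -1); last by ring.
  by rewrite ln1 !powR_inv1//; field.
exists (3 `^ (2 + 1) * J 2).
  by rewrite mulr_gt0 ?powR_gt0// J2; have := ln5_gt; lra.
move=> k k3; have k0 : 0 < k by lra.
pose a := k `^ (alpha + 1); pose b : R := 3 `^ (2 + 1).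
have a0 : 0 < a by exact: powR_gt0.
have dl t : 0 < t -> is_derive t 1 l (phi1 2 t).
  move=> t0; have ? := is_derive1_ln t0; rewrite /l; apply: is_derive_eq.
  rewrite /GRing.scale/= /phi1 (_ : (2 == 1 :> R) = false); last first.
    by apply/negbTE; rewrite gt_eqF//; lra.
  rewrite (_ : 1 - 2 = -1); last by ring.
  by rewrite (powR_inv1 (ltW t0)); field; rewrite gt_eqF.
pose F0 (x : R) := a * oddJ0 (phi alpha) (phi1 alpha) k x - b * J x.
pose F1 (x : R) := a * oddJ1 (phi1 alpha) (phi2 alpha) k x - b * oddJ1 (phi1 2)
  (phi2 2) 3 x.
pose F2 (x : R) := a * oddJ2 (phi2 alpha) (phi3 alpha) k x - b * oddJ2 (phi2 2)
  (phi3 2) 3 x.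
pose F3 (x : R) := a * oddJ3 (phi3 alpha) (phi4 alpha) k x - b * oddJ3 (phi3 2)
  (phi4 2) 3 x.
have := @triple_derive_ge0 F0 F1 F2 F3 2 (ler0n _ 2).
have H : oddJ0 (phi alpha) (phi1 alpha) k 2 =
  - ((phi1 alpha (k + 2) + 6 * phi1 alpha k + phi1 alpha (k - 2)) / 2)
    + phi alpha (k + 2) - phi alpha (k - 2) by rewrite /oddJ0; field.
have akphi : phi3 alpha k = a^-1.
  by rewrite /phi3 /a -powRN; congr (_ `^ _); ring.
move=> T; rewrite akphi -H ler_pdivrMr// -/b [leRHS]mulrC -subr_ge0; apply: T.
- move=> x x02; have xk : 0 <= x < k by lra.
  have x3 : 0 <= x < 3 by lra.
  have ? := @is_derive_oddJ0 _ _ _ k (is_derive_phi alpha0 alpha2)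
    (is_derive_phi1 alpha0) x xk.
  have ? := @is_derive_oddJ0 _ _ _ 3 dl (is_derive_phi1 two0) x x3.
  by apply: is_derive_eq.
- move=> x x02; have xk : 0 <= x < k by lra.
  have x3 : 0 <= x < 3 by lra.
  have ? := @is_derive_oddJ1 _ _ _ k (is_derive_phi1 alpha0) (is_derive_phi2
    alpha0) x xk.
  have ? := @is_derive_oddJ1 _ _ _ 3 (is_derive_phi1 two0) (is_derive_phi2 two0)
    x x3.
  by apply: is_derive_eq.
- move=> x x02; have xk : 0 <= x < k by lra.
  have x3 : 0 <= x < 3 by lra.
  have ? := @is_derive_oddJ2 _ _ _ k (is_derive_phi2 alpha0) (@is_derive_phi3
    alpha) x xk.
  have ? := @is_derive_oddJ2 _ _ _ 3 (is_derive_phi2 two0) (@is_derive_phi3 2) x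
    x3.
  by apply: is_derive_eq.
- by rewrite /F0 /J !oddJ0_0 !mulr0 subrr.
- by rewrite /F1 !oddJ1_0 !mulr0 subrr.
- by rewrite /F2 !oddJ2_0 !mulr0 subrr.
- move=> x x02; rewrite /F3.
  have xk : 0 <= x < k by lra.
  have x3 : 0 <= x < 3 by lra.
  rewrite !oddJ3_phi// subr_ge0.
  have -> : b * (3 `^ (- 2 - 1) * oddN (2 + 2) (x / 3) / 4) = oddN 4 (x / 3) /
    4.
    rewrite /b !mulrA -powRD; last by rewrite implybE (gt_eqF (ltr0Sn _ 2))
      orbT.
    rewrite (_ : 2 + 1 + (- 2 - 1) = 0 :> R); last by ring.
    by rewrite powRr0 mul1r (_ : 2 + 2 = 4 :> R)//; ring.
  have -> : a * (k `^ (- alpha - 1) * oddN (alpha + 2) (x / k) / 4) =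
      oddN (alpha + 2) (x / k) / 4.
    rewrite /a !mulrA -powRD; last by rewrite implybE (gt_eqF k0) orbT.
    rewrite (_ : alpha + 1 + (- alpha - 1) = 0 :> R); last by ring.
    by rewrite powRr0 mul1r.
  rewrite ler_pM2r ?invr_gt0//.
  have x31 : 0 <= x / 3 < 1 by lra.
  have h0 := alpha0; have h2 := alpha2.
  apply: (@le_trans _ _ (oddN (alpha + 2) (x / 3))); first
    by apply: oddN_ge4 => //; lra.
  apply: oddN_nincr; [lra| |lra].
  rewrite divr_ge0/= ?(ltW k0)//; last by lra.
  by rewrite ler_pM2l ?lef_pV2 ?posrE//; lra.
Qed.

End odd.

(** * Positivity of the Gamma integral *)

Section gamma.
Notation leb := (@lebesgue_measure R).
Variable s : R.
Hypotheses (s0 : 0 < s) (s2 : s < 2).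

Definition gamma_density (t : R) := t `^ (s - 1) * expR (- t).

(** Same singularity at 0 as the Gamma density, integrable decay at infinity, and an explicit
    primitive, s^-1 (t / (1 + t))^s. *)
Let major (t : R) := t `^ (s - 1) * (1 + t) `^ (- s - 1).

(** 27 exp t >= 27 (1 + t/3)^3 = (3 + t)^3 >= (1 + t)^3, and s + 1 <= 3. *)
Let gamma_density_le (t : R) : 0 <= t -> gamma_density t <= 27 * major t.
Proof.
move=> t0; rewrite /gamma_density /major mulrCA ler_wpM2l ?powR_ge0//.
have s0' := s0; have s2' := s2.
have e3 : (1 + t) ^+ 3 <= 27 * expR t.
  have -> : expR t = expR (t / 3) ^+ 3 by rewrite -expRM_natl; congr expR;
    field.
  have : 1 + t / 3 <= expR (t / 3) by exact: expR_ge1Dx.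
  have -> : 27 = 3 ^+ 3 :> R by ring.
  by move=> h; rewrite -exprMn lerXn2r// ?nnegrE; lra.
have t1 : 0 < 1 + t by lra.
rewrite (_ : - s - 1 = - (s + 1)); last by ring.
rewrite expRN powRN -[leLHS]mul1r ler_pdivrMr ?expR_gt0//.
rewrite mulrAC ler_pdivlMr ?powR_gt0// mul1r; apply: le_trans e3.
by rewrite -powR_mulrn ?(ltW t1)// ler_powR//; lra.
Qed.

Let F (t : R) := (t / (1 + t)) `^ s.

Let is_derive_F (t : R) : 0 < t -> is_derive t 1 F (s * major t).
Proof.
move=> t0; have t1 : 0 < 1 + t by rewrite addr_gt0.
have q0 : 0 < t / (1 + t) by rewrite divr_gt0.
have d1 : is_derive t 1 (fun x : R => 1 + x) 1 by apply: is_derive_eq; ring.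
have d2 : is_derive t 1 (fun x : R => (1 + x)^-1) (- (1 + t) ^- 2 * 1).
  have := @is_deriveV _ (fun x : R => 1 + x) t 1 1 (lt0r_neq0 t1) d1.
  by [].
have d3 : is_derive t 1 (fun x : R => x / (1 + x)) ((1 + t) ^- 2).
  apply: is_derive_eq; rewrite /GRing.scale/=; field; lra.
have d4 := @is_derive1_comp _ (@powR R ^~ s) (fun x : R => x / (1 + x)) t _ _
  (is_derive1_powR s q0) d3.
apply: (is_derive_eq d4); rewrite /major -mulrA; congr (_ * _).
rewrite powRM ?invr_ge0 ?(ltW t0) ?(ltW t1)// -mulrA; congr (_ * _).
rewrite -(powR_inv1 (ltW t1)) -powRrM -powR_invn ?(ltW t1)//.
rewrite -powRD ?(gt_eqF t1) ?implybT//; congr (_ `^ _); ring.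
Qed.

Let cvgF : F x @[x --> +oo] --> (1 : R).
Proof.
have h : x / (1 + x) @[x --> +oo] --> (1 : R).
  apply/cvgrPdist_le => e e0; near=> x.
  have x1 : 0 < 1 + x.
    by rewrite addr_gt0//; near: x; exact: nbhs_pinfty_gt.
  have -> : 1 - x / (1 + x) = (1 + x)^-1 by field; lra.
  rewrite ger0_norm ?invr_ge0 ?(ltW x1)//.
  rewrite -[e]invrK lef_pV2 ?posrE ?invr_gt0//.
  have : e^-1 < x by near: x; apply: nbhs_pinfty_gt; exact: num_real.
  lra.
have c1 : {for 1, continuous (@powR R ^~ s)}.
  have := is_derive1_powR s (@ltr01 R) => -[d _].
  by apply/differentiable_continuous/derivable1_diffP.
have := @continuous_cvg _ _ _ (+oo)%R _ _ (@powR R ^~ s) 1 c1 h.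
by rewrite powR1; apply.
Unshelve. all: end_near. Qed.

Let integral_major (e : R) : 0 < e ->
  (\int[leb]_(t in `[e, +oo[) (major t)%:E <= (s^-1)%:E)%E.
Proof.
move=> e0.
have dm t : 0 < t -> is_derive t 1 (fun t => s^-1 * F t) (major t).
  move=> t0; have ? := is_derive_F t0; apply: is_derive_eq.
  by rewrite /GRing.scale/= mulrA mulVf ?mul1r// gt_eqF.
have cF t : 0 < t -> {for t, continuous (fun t => s^-1 * F t)}.
  by move=> t0; have [d _] := dm t t0;
    apply/differentiable_continuous/derivable1_diffP.
have cm t : 0 < t -> {for t, continuous major}.
  move=> t0; have t1 : 0 < 1 + t by rewrite addr_gt0.
  have ? := is_derive1_powR (s - 1) t0.
  have ? := is_derive_shiftD (is_derive1_powR (- s - 1) t1).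
  have [d _] : is_derive t 1 major (major t * 0 + (t `^ (s - 1) *
     ((- s - 1) * (1 + t) `^ (- s - 1 - 1)) + (1 + t) `^ (- s - 1) *
     ((s - 1) * t `^ (s - 1 - 1)))).
    by rewrite /major; apply: is_derive_eq; rewrite /GRing.scale/=; ring.
  exact/differentiable_continuous/derivable1_diffP.
rewrite (@ge0_continuous_FTC2y R major (fun t => s^-1 * F t) e (s^-1 * 1)).
- rewrite mulr1 -EFinB lee_fin lerBlDr lerDl mulr_ge0 ?powR_ge0//
  invr_ge0 ltW//.
- by move=> x _; rewrite mulr_ge0 ?powR_ge0.
- apply: continuous_in_subspaceT => x; rewrite inE/= in_itv/= andbT => ex.
  by apply: cm; exact: lt_le_trans ex.
- by apply: cvgM; [exact: cvg_cst|exact: cvgF].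
- by move=> x ex; have [] := dm x (lt_trans e0 ex).
- by apply: cvg_at_right_filter; exact: cF.
- move=> x; rewrite in_itv/= andbT => ex; rewrite derive1E.
  by have [] := dm x (lt_trans e0 ex).
Qed.

Lemma measurable_gamma_density : measurable_fun [set: R] gamma_density.
Proof.
apply: measurable_funM; first exact: measurable_powR.
by apply: measurableT_comp => //; exact: measurableT_comp.
Qed.

(** The real integral is [fine] of an extended one and would be 0 if that were infinite, so
    finiteness has to be shown too. The half-line is exhausted by the sets [B n], which stay away
    from the possible singularity at 0. *)
Lemma Gamma_pos_gt0 : 0 < Gamma_pos s.
Proof.
have mg D : measurable_fun D (EFin \o gamma_density).
  apply/measurable_EFinP; apply: measurable_funTS;
    exact: measurable_gamma_density.
have g0 (t : R) : (0 <= (gamma_density t)%:E)%E.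
  by rewrite lee_fin mulr_ge0 ?powR_ge0 ?expR_ge0.
pose B (n : nat) : set R := `[n.+1%:R^-1, +oo[%classic.
have UB : \bigcup_n B n = `]0%R, +oo[%classic.
  apply/seteqP; split => [x [n _]|x]; rewrite /B/= !in_itv/= !andbT.
    by apply: lt_le_trans; rewrite invr_gt0.
  move=> x0; exists (Num.truncn x^-1) => //=; rewrite in_itv/= andbT.
  rewrite -[leRHS]invrK lef_pV2 ?posrE ?invr_gt0// ltW// truncnS_gt//.
have ndB : nondecreasing_seq B.
  move=> m n mn; apply/subsetPset => x; rewrite /B/= !in_itv/= !andbT.
  by apply: le_trans; rewrite lef_pV2 ?posrE// ler_nat.
have fin : (\int[leb]_(t in `]0%R, +oo[) (gamma_density t)%:E <= (27 *
  s^-1)%:E)%E.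
  have c : (\int[leb]_(t in B n) (gamma_density t)%:E @[n --> \oo] -->
      \int[leb]_(t in \bigcup_n B n) (gamma_density t)%:E)%E.
    apply: ge0_nondecreasing_set_cvg_integral => //.
    - by move=> n; exact: measurable_itv.
    - by move=> n; exact: mg.
  rewrite UB in c.
  rewrite -(cvg_lim _ c)//; apply: lime_le; first exact: cvgP c.
  apply: nearW => n.
  apply: (@le_trans _ _ (\int[leb]_(t in B n) (27 * major t)%:E)%E).
    apply: ge0_le_integral => //.
    - exact: measurable_itv.
    - exact: mg.
    - apply/measurable_EFinP; apply: measurable_funTS;
      apply: measurable_funM => //.
      apply: measurable_funM; first exact: measurable_powR.
      by apply: (measurableT_comp (measurable_powR _)); exact: measurable_funD.
    - move=> t; rewrite /B/= in_itv/= andbT => nt; rewrite lee_fin.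
      by apply: gamma_density_le; apply: le_trans nt; rewrite invr_ge0.
  under eq_integral do rewrite EFinM.
  rewrite ge0_integralZl//.
  - by rewrite EFinM lee_wpmul2l// integral_major// invr_gt0.
  - exact: measurable_itv.
  - apply/measurable_EFinP; apply: measurable_funTS.
    apply: measurable_funM; first exact: measurable_powR.
    by apply: (measurableT_comp (measurable_powR _)); exact: measurable_funD.
  - by move=> t _; rewrite lee_fin mulr_ge0 ?powR_ge0.
have pos : (0 < \int[leb]_(t in `]0%R, +oo[) (gamma_density t)%:E)%E.
  pose c := (2 `^ (- 1) * expR (- 2) : R).
  have c0 : 0 < c by rewrite mulr_gt0 ?powR_gt0 ?expR_gt0.
  apply: (@lt_le_trans _ _ (\int[leb]_(t in `[1%R, 2%R]) c%:E)%E).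
    rewrite integral_cst//= lebesgue_measure_itv/= lte_fin ltr1n.
    by rewrite -EFinD -EFinM lte_fin mulr_gt0//; lra.
  apply: (@le_trans _ _ (\int[leb]_(t in `[1%R, 2%R]) (gamma_density t)%:E)%E).
    apply: ge0_le_integral => //.
    - by move=> t _; rewrite lee_fin ltW.
    - exact: mg.
    - move=> t /=; rewrite in_itv/= => /andP[t1 t2].
      have t0 : 0 < t by exact: lt_le_trans t1.
      have s0' := s0.
      rewrite lee_fin /c /gamma_density ler_pM ?powR_ge0 ?expR_ge0//.
        apply: (@le_trans _ _ (t `^ (- 1))).
          by rewrite (powR_inv1 (ltW t0)) powR_inv1// lef_pV2 ?posrE.
        by rewrite ler_powR//; lra.
      by rewrite ler_expR lerN2.
  apply: ge0_subset_integral => //; first exact: mg.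
  by move=> t /=; rewrite !in_itv/= andbT => /andP[t1 _]; exact: lt_le_trans t1.
rewrite /Gamma_pos /Rintegral -/(gamma_density _); apply: fine_gt0;
  rewrite pos/=.
by apply: le_lt_trans fin _; rewrite ltry.
Qed.

End gamma.

Lemma C1_gt0 (alpha : R) : 0 < alpha -> alpha < 2 -> 0 < C1 alpha.
Proof.
move=> a0 a2; rewrite /C1 divr_gt0//.
  rewrite mulr_gt0 ?powR_gt0// /Gamma ifT; last by lra.
  by rewrite addr0 big_ord0 divr1 Gamma_pos_gt0//; lra.
rewrite mulr_gt0 ?sqrtr_gt0 ?pi_gt0// normr_gt0 /Gamma ifF; last first.
  by apply/negbTE; rewrite -leNgt; lra.
(* As - alpha / 2 lies in ]-1, 0[, one use of the functional equation suffices: Gamma (- alpha / 2)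
   is Gamma (1 - alpha / 2) divided by - alpha / 2. *)
have -> : Num.truncn (- (- alpha / 2)) = 0%N.
  by apply/eqP; rewrite truncn_eq; lra.
rewrite big_ord1 addr0 mulf_neq0//.
  by rewrite gt_eqF// Gamma_pos_gt0//; lra.
by rewrite invr_eq0; lra.
Qed.

Lemma betah_ge (alpha : R) : 0 < alpha -> alpha < 2 ->
  exists2 c : R, 0 < c & forall h (k : int), 0 < h -> k != 0 ->
    c * (`|k|%:~R * h) `^ (- (1 + alpha)) <= betah alpha h k.
Proof.
move=> a0 a2; have C0 := C1_gt0 a0 a2.
have [c c0 Hc] := odd_weight_ge a0 a2.
(* The three bounds serve |k| = 1, even k (the prefactor 2 times 1/3) and odd |k| >= 3. *)
pose c1 : R := Num.min (Num.min (2 - alpha)^-1 (2 / 3)) c.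
have c10 : 0 < c1.
  by rewrite !lt_min c0 andbT divr_gt0// invr_gt0 subr_gt0 a2.
exists (C1 alpha * c1); first by rewrite mulr_gt0.
move=> h k h0 k0.
have n0 : (0 < `|k|)%N by rewrite absz_gt0.
set n := `|k|%N in n0.
have kn : (`|k|%:~R : R) = n%:R by rewrite -abszE.
have nR : (0 : R) < n%:R by rewrite ltr0n.
have hp : 0 < h `^ (1 + alpha) by exact: powR_gt0.
have -> : C1 alpha * c1 * (`|k|%:~R * h) `^ (- (1 + alpha)) =
    C1 alpha / h `^ (1 + alpha) * (c1 * phi3 alpha n%:R).
  rewrite kn powRM ?(ltW nR) ?(ltW h0)// (powRN h) /phi3.
  by rewrite (_ : - (1 + alpha) = - alpha - 1); ring.
have Ch : 0 < C1 alpha / h `^ (1 + alpha) by rewrite divr_gt0.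
have p3 : 0 <= phi3 alpha n%:R by rewrite ltW ?phi3_gt0.
have c1a : c1 <= (2 - alpha)^-1 by rewrite /c1 !ge_min lexx.
have c1b : c1 <= 2 / 3 by rewrite /c1 !ge_min lexx !orbT.
have c1c : c1 <= c by rewrite /c1 !ge_min lexx !orbT.
rewrite /betah; cbv zeta; rewrite -/n (gtn_eqF n0).
case: ifPn => [/eqP n1|n1].
  rewrite n1 ler_pM2l// derive1n2_phi// !derive1_phi//.
  have := first_weight_ge0 a0 a2; rewrite /phi3 powR1 mulr1; lra.
case: ifPn => [en|on].
  have n2 : (2 <= n%:R :> R) by rewrite (ler_nat _ 2) ltn_neqAle eq_sym n1.
  have H := even_weight_ge a0 a2 n2.
  rewrite (mulrC 2) -[leRHS]mulrA ler_pM2l// !derive1_phi//; last first.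
    by lra.
  apply: (@le_trans _ _ (2 / 3 * phi3 alpha n%:R)); first by rewrite ler_wpM2r.
  lra.
have n3 : (3 <= n%:R :> R) by move: n0 n1 on; rewrite (ler_nat _ 3);
  case: (n) => [|[|[|m]]].
rewrite ler_pM2l// !derive1_phi//; last first.
  by lra.
by apply: le_trans (Hc _ n3); rewrite ler_wpM2r.
Qed.

End weights.

(** * Unordered sums *)

Section sums.
Context {R : realType}.

Lemma ssum_ge0 (T : choiceType) (a : T -> R) : (forall i, 0 <= a i) ->
  ssum a = (\esum_(i in [set: T]) (a i)%:E)%E.
Proof.
move=> a0; rewrite /ssum.
rewrite [X in (_ - X)%E]esum1 ?sube0; last first.
  by move=> i _; rewrite funenegE /= max_r// lee_fin oppr_le0.
by apply: eq_esum => i _; rewrite funeposE /= max_l// lee_fin.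
Qed.

Lemma esum_EFin_ge0 (T : choiceType) (a : T -> R) : (forall i, 0 <= a i) ->
  (0 <= \esum_(i in [set: T]) (a i)%:E)%E.
Proof. by move=> a0; apply: esum_ge0 => i _; rewrite lee_fin. Qed.

Lemma esumZl (T : choiceType) (a : T -> R) (c : R) : 0 <= c ->
  (forall i, 0 <= a i) ->
  (\esum_(i in [set: T]) (c * a i)%:E = c%:E * \esum_(i in [set: T]) (a
    i)%:E)%E.
Proof.
move=> c0 a0.
have H (b : T -> R) (d : R) : 0 <= d -> (forall i, 0 <= b i) ->
    (\esum_(i in [set: T]) (d * b i)%:E <= d%:E * \esum_(i in [set: T]) (b
      i)%:E)%E.
  move=> d0 b0; apply: ge_ereal_sup => _ [X [finX _]] <-.
  under eq_fsbigr do rewrite EFinM.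
  rewrite -ge0_mule_fsumr; last by move=> i; rewrite lee_fin.
  rewrite lee_wpmul2l ?lee_fin//.
  by apply: esum_ge; exists X.
have [->|cn0] := eqVneq c 0.
  by rewrite mul0e esum1// => i _; rewrite mul0r.
have cp : 0 < c by rewrite lt_def cn0.
apply/eqP; rewrite eq_le H//=.
have := H (fun i => c * a i) c^-1; rewrite invr_ge0 => /(_ c0).
move=> /(_ (fun i => mulr_ge0 c0 (a0 i))).
under eq_esum do rewrite mulKf//.
move=> h; apply: (le_trans (lee_wpmul2l _ h)); rewrite ?lee_fin//.
by rewrite muleA -EFinM mulfV// mul1e.
Qed.

Lemma esumD_EFin (T : choiceType) (a b : T -> R) : (forall i, 0 <= a i) ->
  (forall i, 0 <= b i) ->
  (\esum_(i in [set: T]) (a i + b i)%:E =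
   \esum_(i in [set: T]) (a i)%:E + \esum_(i in [set: T]) (b i)%:E)%E.
Proof.
move=> a0 b0; rewrite -esumD; try by move=> i _; rewrite lee_fin.
by apply: eq_esum => i _; rewrite EFinD.
Qed.

(* Summing [2 t w (x - a) <= t^2 w + w (x - a)^2] and optimizing over [t]. *)
Lemma esum_jensen (T : choiceType) (w a : T -> R) (m s x : R) :
  (forall i, 0 <= w i) ->
  (\esum_(i in [set: T]) (w i)%:E = m%:E)%E -> 0 < m ->
  (\esum_(i in [set: T]) `|(w i * a i)%:E| < +oo)%E ->
  s = fine (ssum (fun i => w i * a i)) ->
  (((x - s / m) ^+ 2)%:E <=
    (m^-1)%:E * \esum_(i in [set: T]) (w i * (x - a i) ^+ 2)%:E)%E.
Proof.
move=> w0 wm m0 sumwa sE.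
pose p i := Num.max (w i * a i) 0; pose n i := Num.max (- (w i * a i)) 0.
have p0 i : 0 <= p i by rewrite le_max lexx orbT.
have n0 i : 0 <= n i by rewrite le_max lexx orbT.
have pn i : p i - n i = w i * a i.
  rewrite /p /n; case: (leP 0 (w i * a i)) => h.
    by rewrite max_r ?subr0// oppr_le0.
  by rewrite max_l ?oppr_ge0 ?(ltW h)//; ring.
have fin (q : T -> R) : (forall i, 0 <= q i) -> (forall i, q i <= `|w i * a i|)
  ->
    exists Q : R, (\esum_(i in [set: T]) (q i)%:E = Q%:E)%E.
  move=> q0 qle.
  exists (fine (\esum_(i in [set: T]) (q i)%:E)).
  rewrite fineK// ge0_fin_numE ?esum_EFin_ge0//.
  by apply: le_lt_trans sumwa; apply: le_esum => i _; rewrite abse_EFin lee_fin.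
have [P EP] : exists P : R, (\esum_(i in [set: T]) (p i)%:E = P%:E)%E.
  by apply: fin => // i; rewrite ge_max normr_ge0 andbT ler_norm.
have [N EN] : exists N : R, (\esum_(i in [set: T]) (n i)%:E = N%:E)%E.
  by apply: fin => // i; rewrite ge_max normr_ge0 andbT -normrN ler_norm.
have {sE} sE : s = P - N.
  rewrite sE /ssum.
  have -> : (\esum_(i in [set: T]) (EFin \o (fun i => (w i * a i)%R))^\+ i =
    P%:E)%E.
    by rewrite -EP; apply: eq_esum => i _; rewrite funeposE /= EFin_max.
  have -> : (\esum_(i in [set: T]) (EFin \o (fun i => (w i * a i)%R))^\- i =
    N%:E)%E.
    by rewrite -EN; apply: eq_esum => i _; rewrite funenegE /= EFin_max.
  by [].
set D := (\esum_(i in [set: T]) (w i * (x - a i) ^+ 2)%:E)%E.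
have d0 i : 0 <= w i * (x - a i) ^+ 2 by rewrite mulr_ge0// sqr_ge0.
have D0 : (0 <= D)%E by exact: esum_EFin_ge0.
case ED : D D0 => [d| |] // D0; last first.
  by rewrite gt0_muley ?lte_fin ?invr_gt0// leey.
pose t := x - s / m.
(* The coefficients 2 t x and 2 t have unknown sign. Splitting them, like w a into p and n, leaves
   only nonnegative terms on both sides of [key], where extended sums are additive and
   homogeneous. *)
pose c1 := Num.max (2 * t * x) 0; pose c2 := Num.max (- (2 * t * x)) 0.
pose e1 := Num.max (2 * t) 0; pose e2 := Num.max (- (2 * t)) 0.
have maxB (y : R) : Num.max y 0 - Num.max (- y) 0 = y.
  case: (leP 0 y) => h; first by rewrite max_r ?subr0// oppr_le0.
  by rewrite max_l ?oppr_ge0 ?(ltW h)//; ring.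
have cE : c1 - c2 = 2 * t * x by exact: maxB.
have eE : e1 - e2 = 2 * t by exact: maxB.
have [c10 c20 e10 e20] : [/\ 0 <= c1, 0 <= c2, 0 <= e1 & 0 <= e2].
  by rewrite !le_max lexx !orbT.
have t20 : 0 <= t ^+ 2 by exact: sqr_ge0.
have key : c1 * m + (e1 * N + e2 * P) <=
    c2 * m + (e1 * P + (e2 * N + (t ^+ 2 * m + d))).
  have : (\esum_(i in [set: T]) (c1 * w i + (e1 * n i + e2 * p i))%:E <=
      \esum_(i in [set: T]) (c2 * w i + (e1 * p i + (e2 * n i +
         (t ^+ 2 * w i + w i * (x - a i) ^+ 2))))%:E)%E.
    apply: le_esum => i _; rewrite lee_fin -subr_ge0.
    have -> : c2 * w i + (e1 * p i + (e2 * n i + (t ^+ 2 * w i +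
        w i * (x - a i) ^+ 2))) - (c1 * w i + (e1 * n i + e2 * p i)) =
      - (c1 - c2) * w i + (e1 - e2) * (p i - n i) + t ^+ 2 * w i
        + w i * (x - a i) ^+ 2 by ring.
    rewrite cE eE pn.
    have -> : - (2 * t * x) * w i + 2 * t * (w i * a i) + t ^+ 2 * w i
       + w i * (x - a i) ^+ 2 = w i * (t - (x - a i)) ^+ 2 by ring.
    by rewrite mulr_ge0// sqr_ge0.
  have M1 c i : 0 <= c -> 0 <= c * w i by move=> ?; exact: mulr_ge0.
  have M2 c i : 0 <= c -> 0 <= c * p i by move=> ?; exact: mulr_ge0.
  have M3 c i : 0 <= c -> 0 <= c * n i by move=> ?; exact: mulr_ge0.
  rewrite !esumD_EFin; do ?by move=> i; rewrite ?addr_ge0 ?M1 ?M2 ?M3.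
  rewrite !esumZl// wm EP EN -/D ED.
  by rewrite -!EFinM -!EFinD lee_fin.
have tm : t * m = x * m - s by rewrite /t mulrBl divfK// gt_eqF.
rewrite -EFinM lee_fin -/t -(ler_pM2l m0) mulrA mulfV ?gt_eqF// mul1r.
have h1 : (c1 - c2) * m - (e1 - e2) * (P - N) <= t ^+ 2 * m + d by lra.
have h2 : 2 * t * (t * m) <= t ^+ 2 * m + d.
  by rewrite tm sE; move: h1; rewrite cE eE; lra.
by rewrite mulrC; move: h2; rewrite expr2; lra.
Qed.

(** The second term is the integral of t^(-1-alpha) from n + 1 to infinity. Each new summand is at
    most the piece of integral that it replaces, so the left side is nonincreasing in n. *)
Lemma sum_powR_le (alpha : R) (n : nat) : 0 < alpha ->
  \sum_(i < n.+1) (i.+1%:R : R) `^ (- (1 + alpha)) + n.+1%:R `^ (- alpha) /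
    alpha
    <= 1 + alpha^-1.
Proof.
move=> a0; elim: n => [|n ih].
  by rewrite big_ord_recr big_ord0/= !powR1 add0r mul1r.
apply: le_trans ih; rewrite big_ord_recr/= -addrA lerD2l.
set x : R := n.+1%:R; have -> : n.+2%:R = x + 1 by rewrite /x natr1.
have x0 : 0 < x by rewrite ltr0n.
pose r := (x + 1) `^ (- (1 + alpha)).
have : - (x `^ (- alpha)) / alpha - r * x <=
       - ((x + 1) `^ (- alpha)) / alpha - r * (x + 1).
  apply: (@ge0_derive_le R (fun t => - (t `^ (- alpha)) / alpha - r * t)
    (fun t => t `^ (- (1 + alpha)) - r)); first by rewrite lerDl.
    move=> t /andP[xt _]; have t0 : 0 < t by exact: lt_le_trans xt.
    have ? := is_derive1_powR (- alpha) t0; apply: is_derive_eq.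
    rewrite /GRing.scale/= (_ : - alpha - 1 = - (1 + alpha)); last by ring.
    by field; rewrite gt_eqF.
  move=> t /andP[xt tx1]; rewrite subr_ge0 /r !powRN.
  have t0 : 0 < t by exact: lt_trans xt.
  rewrite lef_pV2 ?posrE ?powR_gt0 ?addr_gt0//
    ge0_ler_powR ?nnegrE ?addr_ge0 ?ltW//.
by rewrite -/r; lra.
Qed.

Lemma esum_nat_powR_lty (alpha : R) : 0 < alpha ->
  (\esum_(i in [set: nat]) ((i.+1%:R : R) `^ (- (1 + alpha)))%:E < +oo)%E.
Proof.
move=> a0; rewrite -nneseries_esumT; last by move=> n; rewrite lee_fin powR_ge0.
apply: (@le_lt_trans _ _ (1 + alpha^-1)%:E); last by rewrite ltry.
apply: lime_le; first by apply: is_cvg_nneseries => n _ _;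
  rewrite lee_fin powR_ge0.
apply: nearW => n; rewrite big_mkord sumEFin lee_fin.
case: n => [|n]; first by rewrite big_ord0 addr_ge0// invr_ge0 ltW.
apply: le_trans (sum_powR_le n a0).
by rewrite lerDl divr_ge0 ?powR_ge0// ltW.
Qed.

Lemma esum_int_powR_lty (alpha : R) : 0 < alpha ->
  (\esum_(k in [set: int]) ((`|k|%N.+1%:R : R) `^ (- (1 + alpha)))%:E < +oo)%E.
Proof.
move=> a0; set b := fun k : int => _.
have b0 (k : int) : (0 <= b k)%E by rewrite lee_fin powR_ge0.
rewrite (esumID (range Posz)); last by move=> i _; exact: b0.
rewrite !setTI lte_add_pinfty//.
  rewrite esum_image; first exact: esum_nat_powR_lty.
  by move=> i j _ _ [].
have -> : ~` range Posz = range Negz.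
  apply/seteqP; split => [[n|n]|_ [n _ <-] [m _]] //=.
    by move=> H; exfalso; apply: H; exists n.
  by move=> _; exists n.
rewrite esum_image; last by move=> i j _ _ [].
apply: le_lt_trans (esum_nat_powR_lty a0); apply: le_esum => n _.
rewrite lee_fin /b !powRN lef_pV2 ?posrE ?powR_gt0 ?ltr0n//.
have a1 : 0 <= 1 + alpha by rewrite addr_ge0// ltW.
by apply: (ge0_ler_powR a1); rewrite ?nnegrE ?ler0n// ler_nat.
Qed.

End sums.

(** * The discrete Poincare inequality *)

Section poincare.
Context {R : realType}.
Variable alpha : R.
Hypotheses (alpha0 : 0 < alpha) (alpha2 : alpha < 2).

Let p : R := 1 + alpha.

Let p_gt0 : 0 < p. Proof. by rewrite addr_gt0. Qed.

Lemma M_gt0 (h : R) (j : int) : 0 < M alpha h j.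
Proof. exact: mu_gt0. Qed.

Lemma betah_abs (h : R) (j k : int) : `|j|%N = `|k|%N -> betah alpha h j = betah
  alpha h k.
Proof. by rewrite /betah => ->. Qed.

Lemma betah_ge0 (h : R) (k : int) : 0 < h -> 0 <= betah alpha h k.
Proof.
move=> h0; have [->|k0] := eqVneq k 0; first by rewrite /betah.
have [c c0 Hc] := betah_ge alpha0 alpha2.
by apply: le_trans (Hc h k h0 k0); rewrite mulr_ge0 ?powR_ge0// ltW.
Qed.

Lemma M_min_le : exists2 C : R, 0 < C & forall h (j k : int), 0 < h -> j != k ->
  (`|k| <= `|j|)%N -> M alpha h j <= C * betah alpha h (k - j).
Proof.
have [C C0 HC] := mu_tail alpha0 alpha2.
have [c c0 Hc] := betah_ge alpha0 alpha2.
exists (C * 2 `^ p / c); first by rewrite divr_gt0// mulr_gt0// powR_gt0.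
move=> h j k h0 jk kj.
have j0 : j != 0.
  by apply: contra_neq jk => j0; move: kj; rewrite j0 absz0 leqn0 absz_eq0 =>
    /eqP.
have kj0 : k - j != 0 by rewrite subr_eq0 eq_sym.
have jR : (j%:~R * h : R) != 0 by rewrite mulf_neq0 ?(gt_eqF h0)// intr_eq0.
apply: (le_trans (HC _ jR)); rewrite -mulrA -[leRHS]mulrA ler_pM2l// -/p.
rewrite -ler_pdivrMl ?powR_gt0// mulrC ler_pdivlMl//.
apply: le_trans (Hc h _ h0 kj0); rewrite ler_pM2l// -/p.
have jh0 : 0 < `|j%:~R * h : R| by rewrite normr_gt0.
have kjh0 : 0 < (`|k - j|%:~R * h : R) by rewrite mulr_gt0// ltr0z normr_gt0.
rewrite !powRN -invfM lef_pV2 ?posrE ?mulr_gt0 ?powR_gt0//.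
apply: (@le_trans _ _ ((`|j%:~R * h| * 2) `^ p)); last
  by rewrite powRM ?(ltW jh0).
apply: (ge0_ler_powR (ltW p_gt0)); rewrite ?nnegrE ?(ltW kjh0) ?mulr_ge0//.
rewrite normrM (gtr0_norm h0) -intr_norm mulrAC ler_wpM2r ?(ltW h0)//.
have : `|k - j| <= `|j| *+ 2.
  apply: (le_trans (ler_normB _ _)); rewrite mulr2n lerD2r.
  by rewrite -!abszE lez_nat.
by rewrite -(ler_int R) rmorphMn/= -mulr_natr.
Qed.

(** A Riemann sum over [0, d], where the density is at least c: the N + 1 nodes 0, h, ..., N h lie
    in this interval, and (N + 1) h >= d. For h > d the node 0 alone suffices. *)
Lemma mass_ge : exists2 c : R, 0 < c & forall h, 0 < h ->
  (c%:E <= \esum_(k in [set: int]) (M alpha h k * h)%:E)%E.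
Proof.
have [d [c [d0 c0 Hd]]] := mu_near0 alpha0.
exists (d * c); first exact: mulr_gt0.
move=> h h0; have M0 k : 0 <= M alpha h k * h by rewrite mulr_ge0 ?ltW ?M_gt0.
rewrite (esumID (range Posz)); last by move=> i _; rewrite lee_fin.
rewrite !setTI; apply: (@le_trans _ _
  (\esum_(k in range Posz) (M alpha h k * h)%:E)%E); last first.
  by rewrite leeDl// esum_ge0// => i _; rewrite lee_fin.
rewrite esum_image; last by move=> i j _ _ [].
rewrite -nneseries_esumT; last by move=> n; rewrite lee_fin.
pose N := Num.truncn (d / h).
apply: le_trans (nneseries_lim_ge N.+1 _); last by move=> n _ _;
  rewrite lee_fin.
rewrite big_mkord sumEFin lee_fin.
apply: (@le_trans _ _ (\sum_(i < N.+1) c * h)).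
  rewrite sumr_const card_ord -mulr_natl mulrCA (mulrC d) ler_pM2l//.
  by rewrite -ler_pdivrMr// ltW// truncnS_gt.
apply: ler_sum => i _; rewrite ler_pM2r//; apply: Hd.
rewrite normrM (gtr0_norm h0) -ler_pdivlMr// (ger0_norm (ler0n _ _)).
have : (i <= N)%N by rewrite -ltnS.
rewrite -(ler_nat R) => /le_trans; apply.
by rewrite truncn_le// divr_ge0// ltW.
Qed.

(** The majorant [K] may depend on h. Its maximum covers k = 0, where the tail bound says nothing;
    the h / 2 comes from |k| >= (|k| + 1) / 2 for k != 0. *)
Lemma mass_lty (h : R) : 0 < h ->
  (\esum_(k in [set: int]) (M alpha h k * h)%:E < +oo)%E.
Proof.
move=> h0; have [C C0 HC] := mu_tail alpha0 alpha2.
pose K := Num.max (M alpha h 0) (C * (h / 2) `^ (- p)) * h.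
have K0 : 0 <= K by rewrite mulr_ge0 ?ltW// lt_max M_gt0.
apply: (@le_lt_trans _ _ (\esum_(k in [set: int])
    (K * (`|k|%N.+1%:R : R) `^ (- p))%:E)%E); last first.
  rewrite esumZl//.
  by apply: lte_mul_pinfty; rewrite ?lee_fin//; exact: esum_int_powR_lty.
apply: le_esum => k _; rewrite lee_fin /K mulrAC ler_wpM2r ?(ltW h0)//.
have [->|k0] := eqVneq k 0.
  by rewrite absz0 powR1 mulr1 le_max lexx.
have kR : (k%:~R * h : R) != 0 by rewrite mulf_neq0 ?(gt_eqF h0)// intr_eq0.
apply: (le_trans (HC _ kR)).
apply: (@le_trans _ _ (C * (h / 2) `^ (- p) * (`|k|%N.+1%:R : R) `^ (- p)));
  last first.
  by rewrite ler_wpM2r ?powR_ge0// le_max lexx orbT.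
rewrite -mulrA ler_pM2l// -powRM ?divr_ge0 ?(ltW h0)// -/p !powRN.
have n0 : (0 < `|k|)%N by rewrite absz_gt0.
rewrite normrM (gtr0_norm h0) -intr_norm -abszE.
have n1 : (1 : R) <= `|k|%N%:R by rewrite ler1n.
have nk : (`|k|%N%:Z%:~R : R) = `|k|%N%:R by [].
rewrite nk lef_pV2 ?posrE ?powR_gt0 ?mulr_gt0 ?(lt_le_trans ltr01 n1)//.
rewrite ge0_ler_powR ?nnegrE ?mulr_ge0 ?(ltW p_gt0) ?(ltW h0)//.
rewrite -[`|k|.+1%:R]natr1; move: n1; move: (`|k|%N%:R) => x x1.
have : 0 <= h * (x - 1) by rewrite mulr_ge0 ?subr_ge0// ltW.
lra.
Qed.

(** From |f| <= f^2 / M + M and the finite mass; this is the absolute convergence that [esum_jensen]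
    asks for. *)
Lemma l1_lty (h : R) (f : int -> R) : 0 < h -> (l2norm_sq alpha h f < +oo)%E ->
  (\esum_(k in [set: int]) `|(f k * h)%:E| < +oo)%E.
Proof.
move=> h0; rewrite /l2norm_sq ssum_ge0; last first.
  by move=> k; rewrite mulr_ge0 ?divr_ge0 ?sqr_ge0 ?ltW ?M_gt0.
move=> fin.
have f0 k : 0 <= f k ^+ 2 / M alpha h k * h.
  by rewrite mulr_ge0 ?divr_ge0 ?sqr_ge0 ?ltW ?M_gt0.
have m0 k : 0 <= M alpha h k * h by rewrite mulr_ge0 ?ltW ?M_gt0.
apply: (@le_lt_trans _ _ (\esum_(k in [set: int])
   (f k ^+ 2 / M alpha h k * h + M alpha h k * h)%:E)%E).
  apply: le_esum => k _; rewrite abse_EFin lee_fin -mulrDl normrM (gtr0_norm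
    h0).
  rewrite ler_wpM2r ?(ltW h0)//; have := M_gt0 h k; move: (M _ _ _) => m mp.
  rewrite -(ler_pM2r mp) mulrDl divfK ?gt_eqF// -(real_normK (num_real (f k))).
  have := normr_ge0 (f k); move: `|f k| => x x0.
  have := sqr_ge0 (x - m); nra.
rewrite esumD_EFin// lte_add_pinfty// mass_lty//.
Qed.

Lemma shift_bij : set_bij [set: int * int] [set: int * int]
  (fun jk : int * int => (jk.1, jk.1 + jk.2)).
Proof.
split => //.
- by move=> [j k] [j' k'] _ _ /= [-> /addrI ->].
- by move=> [j k] _; exists (j, k - j) => //=; rewrite addrC subrK.
Qed.

Lemma swap_bij : set_bij [set: int * int] [set: int * int]
  (fun jk : int * int => (jk.2, jk.1)).
Proof.
split => //.
- by move=> [j k] [j' k'] _ _ /= [-> ->].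
- by move=> [j k] _; exists (k, j).
Qed.

Lemma esum_pair (a : int -> int -> R) : (forall j k, 0 <= a j k) ->
  (\esum_(j in [set: int]) \esum_(k in [set: int]) (a j k)%:E =
   \esum_(jk in [set: int * int]) (a jk.1 jk.2)%:E)%E.
Proof.
move=> a0; rewrite (@esum_esum _ _ _ [set: int] (fun=> [set: int])
  (fun j k => (a j k)%:E)); last by move=> j k _ _; rewrite lee_fin.
by congr esum; apply/seteqP; split.
Qed.

Lemma poincare : exists C : R, 0 < C /\
  forall (h : R) (f : int -> R), 0 < h -> (l2norm_sq alpha h f < +oo)%E ->
    (l2norm_sq alpha h (fun j => f j - Pi alpha h f j)%R
      <= C%:E * Sform alpha h f f)%E.
Proof.
have [C C0 HC] := M_min_le; have [c c0 Hc] := mass_ge.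
(* 1 / c bounds 1 / m, and C compares M with the weights; one factor 2 comes from the two equal sums
   obtained from W_j + W_k, the other offsets the 1/2 in [Sform]. *)
exists (4 * C / c); split; first by rewrite divr_gt0// mulr_gt0.
move=> h f h0 ff.
pose W j := M alpha h j; pose F j := f j / W j.
have W0 j : 0 < W j by exact: M_gt0.
have W00 j : 0 <= W j by exact: ltW.
have w0 j : 0 <= W j * h by rewrite mulr_ge0 ?ltW.
pose m := fine (\esum_(k in [set: int]) (W k * h)%:E)%E.
have mE : (\esum_(k in [set: int]) (W k * h)%:E = m%:E)%E.
  by rewrite fineK// ge0_fin_numE; [exact: mass_lty|exact: esum_EFin_ge0].
have cm : c <= m by have := Hc h h0; rewrite mE lee_fin.
have m0 : 0 < m by exact: lt_le_trans cm.
pose s := fine (ssum (fun k => f k * h)).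
have PiE j : Pi alpha h f j = W j * (s / m).
  by rewrite /Pi -/(W j) -/s ssum_ge0.
have fWF j : f j = F j * W j by rewrite /F divfK// gt_eqF.
have l2E : l2norm_sq alpha h (fun j => f j - Pi alpha h f j) =
    (\esum_(j in [set: int]) (W j * h * (F j - s / m) ^+ 2)%:E)%E.
  rewrite /l2norm_sq ssum_ge0; last first.
    by move=> j; rewrite mulr_ge0 ?divr_ge0 ?sqr_ge0 ?ltW ?M_gt0.
  apply: eq_esum => j _; congr EFin; rewrite PiE fWF -/(W j).
  have Wn : W j != 0 by rewrite gt_eqF.
  have mn : m != 0 by rewrite gt_eqF.
  by field; rewrite ?Wn ?mn.
pose S := (\esum_(jk in [set: int * int]) (betah alpha h (jk.2 - jk.1) *
   (F jk.1 - F jk.2) ^+ 2 * W jk.1 * h ^+ 2)%:E)%E.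
have SE : Sform alpha h f f = ((2^-1)%:E * S)%E.
  rewrite /Sform; congr (_ * _)%E; rewrite ssum_ge0; last first.
    move=> [j k]; rewrite mulr_ge0 ?sqr_ge0// mulr_ge0 ?(ltW (W0 j))//.
    by rewrite -mulrA -expr2 mulr_ge0 ?betah_ge0 ?sqr_ge0.
  rewrite /S (reindex_esum _ _ _ _ shift_bij); apply: eq_esum => -[j k] _ /=.
  by congr EFin; rewrite (addrC j) addrK -/(F j) -/(F (k + j)) -/(W j); ring.
have Sge0 j k : 0 <= betah alpha h (k - j) * (F j - F k) ^+ 2 * W j * h ^+ 2.
  apply: mulr_ge0 (sqr_ge0 h); apply: mulr_ge0 (W00 j).
  exact: mulr_ge0 (betah_ge0 _ h0) (sqr_ge0 _).
have Sge0' j k : 0 <= betah alpha h (k - j) * (F j - F k) ^+ 2 * W k * h ^+ 2.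
  apply: mulr_ge0 (sqr_ge0 h); apply: mulr_ge0 (W00 k).
  exact: mulr_ge0 (betah_ge0 _ h0) (sqr_ge0 _).
have q0 j k : 0 <= W k * h * (F j - F k) ^+ 2
  by exact: mulr_ge0 (w0 k) (sqr_ge0 _).
(* Evenness of the weights makes the sum symmetric, so that W_k in place of W_j changes nothing. *)
have S_swap : (\esum_(jk in [set: int * int]) (betah alpha h (jk.2 - jk.1) *
   (F jk.1 - F jk.2) ^+ 2 * W jk.2 * h ^+ 2)%:E = S)%E.
  rewrite /S (reindex_esum _ _ _ _ swap_bij); apply: eq_esum => -[j k] _ /=.
  rewrite (@betah_abs h (k - j) (j - k)); last by rewrite distnC.
  by congr EFin; ring.
rewrite l2E SE.
apply: (@le_trans _ _ (\esum_(j in [set: int]) \esum_(k in [set: int])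
   (m^-1 * (W j * h * (W k * h * (F j - F k) ^+ 2)))%:E)%E).
  apply: le_esum => j _.
  rewrite EFinM esumZl ?invr_ge0 ?(ltW m0)//; last first.
    by move=> k; exact: mulr_ge0 (w0 j) (q0 j k).
  rewrite esumZl//.
  rewrite muleCA lee_wpmul2l ?lee_fin//.
  apply: (@esum_jensen _ _ (fun k => W k * h) F m s (F j)) => //.
    rewrite (eq_esum (b := fun k => `|(f k * h)%:E|%E)) ?l1_lty// => k _.
    by congr (`| (_)%:E |)%E; rewrite (fWF k); ring.
  rewrite /s; congr (fine (ssum _)); apply/funext => k.
  by rewrite (fWF k); ring.
rewrite esum_pair; last first.
  by move=> j k; rewrite mulr_ge0 ?invr_ge0 ?(ltW m0)// mulr_ge0.
apply: (@le_trans _ _ (\esum_(jk in [set: int * int]) (C / c *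
   (betah alpha h (jk.2 - jk.1) * (F jk.1 - F jk.2) ^+ 2 * W jk.1 * h ^+ 2 +
    betah alpha h (jk.2 - jk.1) * (F jk.1 - F jk.2) ^+ 2 * W jk.2 * h ^+
      2))%:E)%E).
  apply: le_esum => -[j k] _ /=; rewrite lee_fin.
  have [->|jk] := eqVneq j k; first by rewrite !subrr expr0n/= !(mulr0, mul0r)
    addr0 mulr0.
  (* The factor with the index of larger modulus is bounded by C times the weight, the other one by
     the sum W_j + W_k. *)
  have WW : W j * W k <= C * betah alpha h (k - j) * (W j + W k).
    have Cb : 0 <= C * betah alpha h (k - j) by rewrite mulr_ge0 ?betah_ge0//
      ltW.
    have [kj|/ltnW kj] := leqP `|k| `|j|.
      have := HC h j k h0 jk kj; rewrite -/(W j) => Wj.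
      have := W0 j; have := W0 k; nra.
    have := HC h k j h0; rewrite eq_sym => /(_ jk kj); rewrite -/(W k).
    rewrite (@betah_abs h (j - k) (k - j)); last by rewrite distnC.
    move=> Wk; have := W0 j; have := W0 k; nra.
  have Q0 : 0 <= (F j - F k) ^+ 2 * h ^+ 2 by rewrite mulr_ge0 ?sqr_ge0.
  have mc : m^-1 <= c^-1 by rewrite lef_pV2 ?posrE.
  have m10 : 0 <= m^-1 by rewrite invr_ge0 ltW.
  have WWQ := ler_wpM2r Q0 WW.
  apply: (@le_trans _ _ (c^-1 * (W j * h * (W k * h * (F j - F k) ^+ 2)))).
    by apply: ler_wpM2r mc; exact: mulr_ge0 (w0 j) (q0 j k).
  rewrite (mulrC C) -!mulrA ler_pM2l ?invr_gt0//.
  by move: WWQ; lra.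
rewrite esumZl; last 2 first.
- by rewrite divr_ge0 ?(ltW C0) ?(ltW c0).
- by move=> jk; rewrite addr_ge0.
rewrite esumD_EFin//.
rewrite S_swap -/S muleA -EFinM.
have -> : 4 * C / c * 2^-1 = C / c * 2 by field; rewrite gt_eqF.
have -> : (S + S = 2%:E * S)%E by rewrite -mule2n -mule_natl.
by rewrite muleA -EFinM.
Qed.

End poincare.

Unset Implicit Arguments.

Theorem proposition4p5 (R : realType) (alpha : R)
    (alpha_gt0 : 0 < alpha) (alpha_lt2 : alpha < 2) :
  exists C : R, 0 < C /\
    forall (h : R) (f : int -> R), 0 < h ->
      (l2norm_sq alpha h f < +oo)%E ->
      (l2norm_sq alpha h (fun j => f j - Pi alpha h f j)%R
        <= C%:E * Sform alpha h f f)%E.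
Proof. exact: poincare. Qed.
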